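(* Let $B\subset\mathbb{R}^4$ be a bounded domain. Let $H^2_D$ be a complex Hilbert space and let $\hat x_1,\hat x_2,\hat x_3,\hat x_4$ be four bounded Hermitian operators on $H^2_D$ satisfying $$[\hat x_1,\hat x_2]+[\hat x_3,\hat x_4]=0,\quad [\hat x_1,\hat x_3]+[\hat x_4,\hat x_2]=0,\quad [\hat x_1,\hat x_4]+[\hat x_2,\hat x_3]=0.$$ Assume that the operator $4\pi^2\sum_\mu(\hat x_\mu-y_\mu)^2$ on $H^2_D$ is invertible for all $y\in B$. For $y\in B$ let $$\hat{\hat E}_y=\ker\Big(-2\pi i\sum_\mu(\hat x_\mu-y_\mu)\hat c_\mu:H^2_D\otimes S_-\to H^2_D\otimes S_+\Big).$$ Then $\hat{\hat E}$ is a nonsingular Hermitian bundle over $B$, and the subbundle connection $\hat{\hat A}$ on $\hat{\hat E}\subset H^2_D\otimes S_-$ is ASD.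
   Context: $S_\pm$ are the 2-dimensional complex spinor spaces of $\mathbb{R}^4$ with anti-self-adjoint Clifford multiplications $\hat c_\mu:S_\pm\to S_\mp$, $\hat c_\mu\hat c_\nu+\hat c_\nu\hat c_\mu=-2\delta_{\mu\nu}$; the chirality convention is that ASD 2-forms act trivially on $S_+$ and self-dual 2-forms act trivially on $S_-$. ''Nonsingular Hermitian bundle'' means a smooth Hermitian vector bundle whose fibres may be (possibly infinite dimensional) Hilbert spaces, i.e. the orthogonal projection onto the fibre depends smoothly on $y$. The subbundle connection is the orthogonal projection of the trivial connection on the trivial Hilbert bundle $B\times(H^2_D\otimes S_-)$. ASD means the curvature satisfies $*F=-F$. *)

(* Defs.v *)
From HB Require Import structures.
From mathcomp Require Import all_boot all_order all_algebra.
From mathcomp Require Import sesquilinear.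
From mathcomp Require Import complex.
From mathcomp Require Import all_classical all_reals all_analysis.

Set Implicit Arguments.
Unset Strict Implicit.
Unset Printing Implicit Defensive.

Import Order.TTheory GRing.Theory Num.Theory.
Import numFieldNormedType.Exports.

Local Open Scope classical_set_scope.
Local Open Scope ring_scope.
Local Open Scope complex_scope.

Section Forms.
Variables (K : fieldType) (W : lmodType K).

Definition levi_civita (mu nu rho sigma : 'I_4) : K :=
  \det (\matrix_(i < 4, j < 4) (tnth [tuple mu; nu; rho; sigma] i == j)%:R).

(* A W-valued 2-form on R^4 is given at a point by its coefficients F mu nu in
   the standard oriented basis:  F = 1/2 sum_(mu, nu) F mu nu dx_mu /\ dx_nu. *)
Definition two_form (F : 'I_4 -> 'I_4 -> W) : Prop :=
  forall mu nu, F mu nu = - F nu mu.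

Definition hodge (F : 'I_4 -> 'I_4 -> W) (mu nu : 'I_4) : W :=
  2^-1 *: \sum_(rho < 4) \sum_(sigma < 4)
            levi_civita mu nu rho sigma *: F rho sigma.

Definition self_dual (F : 'I_4 -> 'I_4 -> W) : Prop :=
  forall mu nu, hodge F mu nu = F mu nu.

Definition anti_self_dual (F : 'I_4 -> 'I_4 -> W) : Prop :=
  forall mu nu, hodge F mu nu = - F mu nu.

End Forms.

Section Spinors.
Variable R : realType.
Local Notation C := (R[i]).

(* S_+ and S_- are both identified with C^2 (column vectors) by the choice of
   orthonormal bases; cp mu : S_+ -> S_- and cm mu : S_- -> S_+ are the matrices
   of Clifford multiplication. *)
Definition clifford_form (c c' : 'I_4 -> 'M[C]_2) (w : 'I_4 -> 'I_4 -> R^o) :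
    'M[C]_2 :=
  2^-1 *: \sum_(mu < 4) \sum_(nu < 4) (w mu nu)%:C *: (c' mu *m c nu).

Definition clifford_multiplication (cp cm : 'I_4 -> 'M[C]_2) : Prop :=
  [/\ forall mu, cm mu = - map_mx Num.conj (cp mu)^T,
      forall mu nu,
        cm mu *m cp nu + cm nu *m cp mu = (- 2 * (mu == nu)%:R)%:M,
      forall mu nu,
        cp mu *m cm nu + cp nu *m cm mu = (- 2 * (mu == nu)%:R)%:M,
      forall w, two_form w -> anti_self_dual w -> clifford_form cp cm w = 0
    & forall w, two_form w -> self_dual w -> clifford_form cm cp w = 0].

End Spinors.

Section Calculus.
Variable R : realType.
Local Notation C := (R[i]).
Local Notation point := 'rV[R]_4.

Definition domain (B : set point) : Prop := [/\ open B, connected B & B !=set0].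

Definition diff_quotient (W : lmodType C) (f : point -> W) (mu : 'I_4)
    (y : point) (h : R) : W :=
  (h^-1)%:C *: (f (y + h *: delta_mx 0 mu) - f y).

(* The notion of convergence cv in W is a parameter, so that operator-valued
   maps can be differentiated in the norm topology (see op_cvg below). *)
Fixpoint Ck (W : lmodType C) (cv : set_system W -> W -> Prop) (B : set point)
    (k : nat) (f : point -> W) : Prop :=
  (forall y, B y -> cv (f y' @[y' --> y]) (f y)) /\
  (if k is k'.+1 then
     forall mu : 'I_4, exists2 g : point -> W,
       forall y, B y -> cv (diff_quotient f mu y h @[h --> (0 : R)^']) (g y)
       & Ck cv B k' g
   else True).

Definition smooth (W : lmodType C) (cv : set_system W -> W -> Prop)
    (B : set point) (f : point -> W) : Prop :=
  forall k, Ck cv B k f.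

Definition vec_cvg (V : normedModType C) (F : set_system V) (v : V) : Prop :=
  F --> v.

(* On linear maps, uniform convergence on the unit ball is convergence in
   operator norm. *)
Definition op_cvg (V : normedModType C) (F : set_system (V -> V))
    (A : V -> V) : Prop :=
  {uniform [set v : V | `|v| <= 1], F --> A}.

Definition pderiv (V : normedModType C) (mu : 'I_4) (s : point -> V)
    (y : point) : V :=
  lim (diff_quotient s mu y h @[h --> (0 : R)^']).

End Calculus.

Section Operators.
Variables (R : realType) (H : completeNormedModType R[i]).
Local Notation C := (R[i]).

Definition hilbert_norm (dot : {dot H for Num.conj}) : Prop :=
  forall v : H, `|v| ^+ 2 = dot v v.

Definition bounded_op (A : H -> H) : Prop :=
  exists M : C, forall v, `|A v| <= M * `|v|.

Definition hermitian_op (dot : {dot H for Num.conj}) (A : H -> H) : Prop :=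
  forall u v, dot (A u) v = dot u (A v).

Definition commutator (A B : H -> H) (v : H) : H := A (B v) - B (A v).

Definition invertible_op (A : H -> H) : Prop :=
  exists2 G : {linear H -> H}, bounded_op G & cancel A G /\ cancel G A.

Definition shifted (x : 'I_4 -> {linear H -> H}) (y : 'rV[R]_4) (mu : 'I_4)
    (v : H) : H :=
  x mu v - (y 0 mu)%:C *: v.

Definition laplacian (x : 'I_4 -> {linear H -> H}) (y : 'rV[R]_4) (v : H) : H :=
  (4 * pi ^+ 2)%:C *: \sum_(mu < 4) shifted x y mu (shifted x y mu v).

(* H (x) C^2: the pair (w1, w2) stands for w1 (x) e1 + w2 (x) e2.  The norm of
   the product type is the maximum norm; it is equivalent to the norm of
   spinor_dot, and only its topology is used. *)
Definition spinor : normedModType C := (H * H)%type.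

Definition spinor_dot (dot : {dot H for Num.conj}) (w z : spinor) : C :=
  dot w.1 z.1 + dot w.2 z.2.

Definition tensor_op (A : H -> H) (c : 'M[C]_2) (w : spinor) : spinor :=
  (c 0 0 *: A w.1 + c 0 1 *: A w.2, c 1 0 *: A w.1 + c 1 1 *: A w.2).

Definition dirac_op (x : 'I_4 -> {linear H -> H}) (c : 'I_4 -> 'M[C]_2)
    (y : 'rV[R]_4) (w : spinor) : spinor :=
  - (2 * pi%:C * 'i) *: \sum_(mu < 4) tensor_op (shifted x y mu) (c mu) w.

Definition dirac_kernel (x : 'I_4 -> {linear H -> H}) (c : 'I_4 -> 'M[C]_2)
    (y : 'rV[R]_4) : set spinor :=
  [set w | dirac_op x c y w = 0].

End Operators.

Section Bundles.
Variables (R : realType) (H : completeNormedModType R[i]).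
Variable dot : {dot H for Num.conj}.
Local Notation point := 'rV[R]_4.
Local Notation V := (spinor H).

Definition linear_subspace (E : set V) : Prop :=
  E 0 /\ forall (a : R[i]) (v w : V), E v -> E w -> E (a *: v + w).

Definition is_orthogonal_projection (E : set V) (v p : V) : Prop :=
  E p /\ forall w, E w -> spinor_dot dot (v - p) w = 0.

Definition orthogonal_projection (E : set V) (v : V) : V :=
  xget 0 [set p | is_orthogonal_projection E v p].

Definition nonsingular_hermitian_bundle (B : set point) (E : point -> set V) :
    Prop :=
  (forall y, B y ->
     [/\ linear_subspace (E y), closed (E y) &
         forall v, is_orthogonal_projection (E y) v
                     (orthogonal_projection (E y) v)]) /\
  smooth (@op_cvg R V) B (fun y => orthogonal_projection (E y)).

Definition smooth_section (B : set point) (E : point -> set V)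
    (s : point -> V) : Prop :=
  smooth (@vec_cvg R V) B s /\ forall y, B y -> E y (s y).

Definition subbundle_connection (E : point -> set V) (mu : 'I_4)
    (s : point -> V) (y : point) : V :=
  orthogonal_projection (E y) (pderiv mu s y).

(* The coordinate fields commute, so F(d_mu, d_nu) = [nabla_mu, nabla_nu]. *)
Definition curvature (E : point -> set V) (mu nu : 'I_4) (s : point -> V)
    (y : point) : V :=
  subbundle_connection E mu (subbundle_connection E nu s) y -
  subbundle_connection E nu (subbundle_connection E mu s) y.

Definition subbundle_connection_ASD (B : set point) (E : point -> set V) :
    Prop :=
  forall s, smooth_section B E s -> forall y, B y ->
    anti_self_dual (fun mu nu => curvature E mu nu s y).

End Bundles.

(* Main.v *)
(** Write X_mu = x_mu - y_mu, D = sum_mu X_mu c_mu : H (x) S_- -> H (x) S_+ and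
    D^+ = sum_mu X_mu c_mu : H (x) S_+ -> H (x) S_-, so that D^+ = - D^*.  The
    commutator relations say that the 2-form [x_mu, x_nu] is ASD, hence acts
    trivially on S_+, and D D^+ = - sum_mu X_mu^2.  This is invertible, and its
    inverse G commutes with Clifford multiplication.  Therefore
    P = 1 - D^+ G D is the orthogonal projection onto ker D, and it is smooth in y
    because inversion is.

    Let s be a section of ker D.  Differentiating D s = 0 gives D (d_nu s) = c_nu s;
    since P D^+ = 0, the connection nabla = P d satisfies
    nabla_mu nabla_nu s = P d_mu d_nu s + P c_mu c_nu G s.  By the symmetry of second
    derivatives the curvature is s |-> P (c_mu c_nu - c_nu c_mu) G s, which is ASD
    since self-dual 2-forms act trivially on S_-. *)
Require Import Defs.
From HB Require Import structures.
From mathcomp Require Import all_boot all_order all_algebra.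
From mathcomp Require Import sesquilinear.
From mathcomp Require Import complex.
From mathcomp Require Import all_classical all_reals all_analysis.
From mathcomp Require Import ring lra.

Set Implicit Arguments.
Unset Strict Implicit.
Unset Printing Implicit Defensive.

Import Order.TTheory GRing.Theory Num.Theory.
Import numFieldNormedType.Exports.

Local Open Scope classical_set_scope.
Local Open Scope ring_scope.

(** * The norm as a real number, so that estimates take place in a total order *)

Section RealNorm.
Context {R : realType} {V : normedModType R[i]}.
Implicit Types (u v : V) (r : R).

(** Derivatives are limits of difference quotients along the coordinate axes, taken in operator
    norm, and smoothness asks for all orders. It is obtained from a class of families of bounded
    operators that is closed under sums, composition and inversion; the Dirac operators belong to it
    because they are affine in [y]. Operators and sections share one calculus: both are maps from a
    type [T] with a weight [w], so the product rule for operator families also differentiates an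
    operator applied to a section.

    The symmetry of second derivatives concerns sections with values in a space of possibly infinite
    dimension. It is reduced to real functions of [y] by pairing with vectors. The norm on pairs is
    the maximum norm, which is not the norm of [spinor_dot], so the reduction is made in each
    component [H], whose norm does come from [dot]. *)

Definition rnorm v : R := complex.Re `|v|.

Lemma rnormE v : `|v| = (rnorm v)%:C%C.
Proof. by rewrite RRe_real // normr_real. Qed.

Lemma rnorm_ge0 v : 0 <= rnorm v.
Proof. by rewrite -lecR -rnormE normr_ge0. Qed.

Lemma rnorm0 : rnorm 0 = 0.
Proof. by rewrite /rnorm normr0. Qed.

Lemma rnorm_eq0 v : rnorm v = 0 -> v = 0.
Proof. by move=> v0; apply: normr0_eq0; rewrite rnormE v0. Qed.

Lemma rnormN v : rnorm (- v) = rnorm v.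
Proof. by rewrite /rnorm normrN. Qed.

Lemma rnormD u v : rnorm (u + v) <= rnorm u + rnorm v.
Proof. by rewrite -lecR rmorphD /= -!rnormE ler_normD. Qed.

Lemma rnormB u v : rnorm (u - v) <= rnorm u + rnorm v.
Proof. by rewrite -[rnorm v]rnormN rnormD. Qed.

Lemma rnormBC u v : rnorm (u - v) = rnorm (v - u).
Proof. by rewrite -rnormN opprB. Qed.

Lemma rnormZ (a : R[i]) v : rnorm (a *: v) = complex.Re `|a| * rnorm v.
Proof.
by rewrite /rnorm normrZ [`|v|]rnormE -[`|a|]RRe_real ?normr_real // -rmorphM.
Qed.

Lemma Re_norm_ge0 (a : R[i]) : 0 <= complex.Re `|a|.
Proof. by rewrite normc_def /= sqrtr_ge0. Qed.

Lemma rnormZr r v : rnorm (r%:C%C *: v) = `|r| * rnorm v.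
Proof. by rewrite rnormZ normc_def /= expr0n addr0 sqrtr_sqr. Qed.

Lemma cvg_rnormP {S} (F : set_system S) {FF : Filter F} (f : S -> V) v :
  f @ F --> v <-> forall e : R, 0 < e -> \forall s \near F, rnorm (f s - v) <= e.
Proof.
rewrite cvgrPdist_le; split=> fv e e0.
  have := fv e%:C%C; rewrite ltcR => /(_ e0); apply: filterS => s.
  by rewrite rnormE lecR rnormBC.
(* A positive element of [R[i]] is real, because the order only compares numbers with equal
   imaginary parts. *)
have eE : e = (complex.Re e)%:C%C by rewrite RRe_real // gtr0_real.
have := fv (complex.Re e); rewrite -ltcR -eE => /(_ e0); apply: filterS => s.
by rewrite rnormE {2}eE lecR rnormBC.
Qed.

End RealNorm.

(** * Convergence and boundedness relative to a weight *)

Section WeightedConvergence.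
Context {R : realType} {V : normedModType R[i]} {T : Type} (w : T -> R).
Hypothesis w_ge0 : forall t, 0 <= w t.

(* For T := V and w := rnorm this is operator norm convergence; for a one-point
   T and w := 1 it is convergence in V. *)
Definition wcvg {S} (F : set_system S) (f : S -> T -> V) (A : T -> V) :=
  forall e : R, 0 < e -> \forall s \near F, forall t, rnorm (f s t - A t) <= e * w t.

(** The bound is strictly positive so that tolerances can be divided by it. *)
Definition wbounded (A : T -> V) :=
  exists2 M : R, 0 < M & forall t, rnorm (A t) <= M * w t.

Lemma wcvg_near {S} (F : set_system S) {FF : Filter F} (f g : S -> T -> V) A :
  (\forall s \near F, f s = g s) -> wcvg F f A -> wcvg F g A.
Proof. by move=> fg fA e /fA; apply: filterS2 fg => s ->. Qed.

Lemma wcvg_cst {S} (F : set_system S) {FF : Filter F} A : wcvg F (fun=> A) A.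
Proof.
move=> e e0; apply: nearW => s t; rewrite subrr rnorm0.
by rewrite mulr_ge0 // ltW.
Qed.

Lemma wcvgD {S} (F : set_system S) {FF : Filter F} (f g : S -> T -> V) A A' :
  wcvg F f A -> wcvg F g A' ->
  wcvg F (fun s t => f s t + g s t) (fun t => A t + A' t).
Proof.
move=> fA gA e e0; have e2 : 0 < e / 2 by rewrite divr_gt0.
apply: filterS2 (fA _ e2) (gA _ e2) => s h1 h2 t.
rewrite opprD addrACA (le_trans (rnormD _ _)) //.
by have := h1 t; have := h2 t; lra.
Qed.

Lemma wboundedD (A A' : T -> V) :
  wbounded A -> wbounded A' -> wbounded (fun t => A t + A' t).
Proof.
case=> M M0 hM [M' M'0 hM']; exists (M + M'); first by rewrite addr_gt0.
move=> t; rewrite (le_trans (rnormD _ _)) // mulrDl lerD //.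
Qed.

Lemma wcvg_bounded {S} (F : set_system S) {FF : Filter F} (f : S -> T -> V) A :
  wcvg F f A -> wbounded A ->
  exists2 M, 0 < M & \forall s \near F, forall t, rnorm (f s t) <= M * w t.
Proof.
move=> fA [M M0 hM]; exists (1 + M); first by rewrite addr_gt0.
apply: filterS (fA 1 ltr01) => s h t.
by rewrite -[f s t](subrK (A t)) (le_trans (rnormD _ _)) // mulrDl lerD.
Qed.

End WeightedConvergence.

(** * Bounded linear operators and convergence of composites *)

Section BoundedLinear.
Context {R : realType} {V : normedModType R[i]}.
Implicit Types (A : V -> V) (u v : V).

Notation C := R[i].

(** A predicate on plain functions: the derivatives and inverses to which it is applied come out of
    existential statements. *)
Definition blinear A :=
  (forall (a : C) u v, A (a *: u + v) = a *: A u + A v) /\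
  wbounded (@rnorm R V) A.

Lemma blinearD A u v : blinear A -> A (u + v) = A u + A v.
Proof. by case=> lA _; have := lA 1 u v; rewrite !scale1r. Qed.

Lemma blinear0 A : blinear A -> A 0 = 0.
Proof. by move=> lA; apply: (@addIr _ (A 0)); rewrite -blinearD // !add0r. Qed.

Lemma blinearZ A (a : C) u : blinear A -> A (a *: u) = a *: A u.
Proof. by move=> lA; rewrite -[a *: u]addr0 lA.1 blinear0 // addr0. Qed.

Lemma blinearN A u : blinear A -> A (- u) = - A u.
Proof. by move=> lA; rewrite -[- u]scaleN1r blinearZ // scaleN1r. Qed.

Lemma blinearB A u v : blinear A -> A (u - v) = A u - A v.
Proof. by move=> lA; rewrite blinearD // blinearN. Qed.

Lemma blinear_sum A (I : Type) (r : seq I) (P : pred I) (f : I -> V) :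
  blinear A -> A (\sum_(i <- r | P i) f i) = \sum_(i <- r | P i) A (f i).
Proof.
move=> lA; elim/big_rec2: _ => [|i y z _ <-]; first exact: blinear0.
by rewrite blinearD.
Qed.

Lemma wbounded_comp {T} (w : T -> R) A (B : T -> V) :
  wbounded (@rnorm R V) A -> wbounded w B -> wbounded w (fun t => A (B t)).
Proof.
case=> M M0 hM [N N0 hN]; exists (M * N); first by rewrite mulr_gt0.
by move=> t; rewrite (le_trans (hM _)) // -mulrA ler_pM2l.
Qed.

Lemma wboundedZ {T} (w : T -> R) (a : C) (B : T -> V) :
  (forall t, 0 <= w t) -> wbounded w B -> wbounded w (fun t => a *: B t).
Proof.
move=> w0 [N N0 hN]; exists ((complex.Re `|a| + 1) * N).
  by rewrite mulr_gt0 // ltr_wpDl // Re_norm_ge0.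
by move=> t; rewrite rnormZ -mulrA ler_pM ?rnorm_ge0 ?hN ?lerDl ?Re_norm_ge0.
Qed.

Lemma wboundedN {T} (w : T -> R) (B : T -> V) :
  wbounded w B -> wbounded w (fun t => - B t).
Proof. by case=> N N0 hN; exists N => // t; rewrite rnormN. Qed.

Lemma blinear_comp A A' : blinear A -> blinear A' -> blinear (fun v => A (A' v)).
Proof.
move=> lA lA'; split; last exact: wbounded_comp lA.2 lA'.2.
by move=> a u v; rewrite lA'.1 lA.1.
Qed.

Lemma blinear_add A A' : blinear A -> blinear A' -> blinear (fun v => A v + A' v).
Proof.
move=> lA lA'; split; last exact: wboundedD lA.2 lA'.2.
by move=> a u v; rewrite lA'.1 lA.1 scalerDr addrACA.
Qed.

Lemma blinear_scale (a : C) A : blinear A -> blinear (fun v => a *: A v).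
Proof.
move=> lA; split; last by apply: wboundedZ lA.2 => v; exact: rnorm_ge0.
by move=> b u v; rewrite lA.1 scalerDr !scalerA mulrC.
Qed.

Lemma blinear_opp A : blinear A -> blinear (fun v => - A v).
Proof.
move=> lA; split; last exact: wboundedN lA.2.
by move=> a u v; rewrite lA.1 opprD scalerN.
Qed.

Lemma blinear_id : blinear (fun v => v).
Proof. by split=> //; exists 1 => // t; rewrite mul1r. Qed.

Lemma blinear_zero : blinear (fun=> 0).
Proof.
split=> [a u v|]; first by rewrite scaler0 addr0.
by exists 1 => // t; rewrite rnorm0 mul1r rnorm_ge0.
Qed.

Lemma blinear_big_sum (I : Type) (r : seq I) (f : I -> V -> V) :
  (forall i, blinear (f i)) -> blinear (fun v => \sum_(i <- r) f i v).
Proof.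
move=> lf; elim: r => [|i r IHr].
  rewrite (_ : (fun v => _) = fun=> 0); first exact: blinear_zero.
  by apply/funext => v; rewrite big_nil.
rewrite (_ : (fun v => _) = fun v => f i v + \sum_(j <- r) f j v).
  exact: blinear_add.
by apply/funext => v; rewrite big_cons.
Qed.

Section Composition.
Context {T : Type} (w : T -> R) {S : Type} (F : set_system S) {FF : Filter F}.

(** Split f (g t) - A (B t) into (f - A) (g t) and A (g t - B t): [g] is eventually bounded by a
    multiple of the weight, and [A] is bounded. With [T := V] this is composition of operators, with
    a one-point [T] evaluation at a vector. *)
Lemma wcvg_comp (f : S -> V -> V) A (g : S -> T -> V) (B : T -> V) :
  blinear A -> wcvg (@rnorm R V) F f A -> wbounded w B -> wcvg w F g B ->
  wcvg w F (fun s t => f s (g s t)) (fun t => A (B t)).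
Proof.
move=> lA fA bB gB e e0.
have [M M0 gM] := wcvg_bounded gB bB; have [N N0 AN] := lA.2.
have e1 : 0 < e / 2 / M by rewrite !divr_gt0.
have e2 : 0 < e / 2 / N by rewrite !divr_gt0.
apply: filterS3 (fA _ e1) gM (gB _ e2) => s fs gs gBs t.
rewrite -(subrK (A (g s t)) (f s (g s t))) -addrA (le_trans (rnormD _ _)) //.
have -> : e * w t = e / 2 / M * (M * w t) + N * (e / 2 / N * w t).
  by field; rewrite !gt_eqF.
apply: lerD.
  by rewrite (le_trans (fs _)) // ler_wpM2l // ltW.
by rewrite -blinearB // (le_trans (AN _)) // ler_wpM2l // ltW.
Qed.

End Composition.
End BoundedLinear.

(** * Operator families depending smoothly on the base point *)

Section SmoothOperatorFamilies.
Context {R : realType} {V : normedModType R[i]}.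
Local Notation point := 'rV[R]_4.
Local Notation C := R[i].
Local Notation nrm := (@rnorm R V).
Implicit Types (f g : point -> V -> V) (y : point) (mu : 'I_4) (k : nat).

Lemma cvg_coordinate_line y mu :
  y + h *: delta_mx 0 mu @[h --> (0 : R)^'] --> y.
Proof.
have {2}-> : y = y + 0 *: delta_mx 0 mu by rewrite scale0r addr0.
apply: cvgD; first exact: cvg_cst.
apply: cvgZ; last exact: cvg_cst.
exact/cvg_within.
Qed.

Definition wderiv {T} (w : T -> R) (f : point -> T -> V) mu y (A : T -> V) :=
  wcvg w (0 : R)^'
    (fun h t => (h^-1)%:C%C *: (f (y + h *: delta_mx 0 mu) t - f y t)) A.

Lemma wcvg_line {T} (w : T -> R) (f : point -> T -> V) mu y A :
  wcvg w (nbhs y) f A ->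
  wcvg w (0 : R)^' (fun h => f (y + h *: delta_mx 0 mu)) A.
Proof. by move=> fA e /fA; exact: cvg_coordinate_line. Qed.

Lemma wderiv_near {T} (w : T -> R) (f g : point -> T -> V) mu y A :
  (\forall y' \near y, f y' = g y') -> wderiv w f mu y A -> wderiv w g mu y A.
Proof.
move=> fg; apply: wcvg_near; near=> h.
have -> : f y = g y by exact: nbhs_singleton fg.
suff -> : f (y + h *: delta_mx 0 mu) = g (y + h *: delta_mx 0 mu) by [].
by near: h; exact: cvg_coordinate_line fg.
Unshelve. all: by end_near. Qed.

Lemma wderiv_cst {T} (w : T -> R) (A : T -> V) mu y :
  (forall t, 0 <= w t) -> wderiv w (fun=> A) mu y (fun=> 0).
Proof.
move=> w0; apply: wcvg_near (wcvg_cst w0 (fun=> 0)).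
by apply: nearW => h; apply/funext => t; rewrite subrr scaler0.
Qed.

Lemma wderivD {T} (w : T -> R) (f g : point -> T -> V) mu y A A' :
  wderiv w f mu y A -> wderiv w g mu y A' ->
  wderiv w (fun y t => f y t + g y t) mu y (fun t => A t + A' t).
Proof.
move=> fA gA; apply: wcvg_near (wcvgD fA gA).
by apply: nearW => h; apply/funext => t; rewrite -scalerDr opprD addrACA.
Qed.

(** The product rule. The quotient is that of [f] applied to the moved value of [g], which requires
    [g] to be continuous at [y], plus [f y] applied to the quotient of [g]. *)
Lemma wderiv_comp {T} (w : T -> R) f (g : point -> T -> V) mu y A B :
  (forall t, 0 <= w t) -> blinear (f y) -> blinear A ->
  wbounded w (g y) -> wbounded w B -> wcvg w (nbhs y) g (g y) ->
  wderiv nrm f mu y A -> wderiv w g mu y B ->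
  wderiv w (fun y t => f y (g y t)) mu y (fun t => A (g y t) + f y (B t)).
Proof.
move=> w0 lf lA bg bB cg fA gB.
pose proof (wcvg_comp lA fA bg (@wcvg_line _ _ _ mu _ _ cg)) as h1.
pose proof (wcvg_comp lf (wcvg_cst (@rnorm_ge0 R V) (f y)) bB gB) as h2.
apply: wcvg_near (wcvgD h1 h2); apply: nearW => h; apply/funext => t.
by rewrite (blinearZ _ _ lf) (blinearB _ _ lf) -scalerDr addrA subrK.
Qed.

Lemma wcvg_scale {S} (F : set_system S) {FF : Filter F} (r : S -> R) (a : R)
    (A : V -> V) :
  blinear A -> r @ F --> a ->
  wcvg nrm F (fun s v => (r s)%:C%C *: A v) (fun v => a%:C%C *: A v).
Proof.
move=> [_ [M M0 hM]] ra e e0.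
have e1 : 0 < e / M by rewrite divr_gt0.
move/cvgrPdistC_le : ra => /(_ _ e1); apply: filterS => s rs v.
rewrite -scalerBl -rmorphB rnormZr.
have -> : e * nrm v = e / M * (M * nrm v) by field; rewrite gt_eqF.
by rewrite ler_pM // rnorm_ge0.
Qed.

Lemma wderiv_coordinate mu nu y (A : V -> V) : blinear A ->
  wderiv nrm (fun y v => (y 0 nu)%:C%C *: A v) mu y
    (fun v => ((mu == nu)%:R : R)%:C%C *: A v).
Proof.
move=> lA; pose A' v := ((mu == nu)%:R : R)%:C%C *: A v.
apply: (wcvg_near _ (wcvg_cst (@rnorm_ge0 R V) A')).
near=> h; apply/funext => v; rewrite -scalerBl scalerA -rmorphB -rmorphM.
rewrite !mxE addrAC subrr add0r eqxx /= eq_sym mulrA mulVf ?mul1r //.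
by near: h; exact: nbhs_dnbhs_neq.
Unshelve. all: by end_near. Qed.

Section Inverse.
Variables (B : set point) (N G : point -> V -> V).
Hypotheses (B_open : open B)
  (blinear_G : forall y, B y -> blinear (G y))
  (NG : forall y, B y -> cancel (N y) (G y))
  (GN : forall y, B y -> cancel (G y) (N y)).

(* The resolvent identity G' - G = G' (N - N') G, with G' bounded near y since
   |u| <= |G| |N u| <= |G| (|N' u| + |(N - N') u|). *)
Lemma wcvg_inverse y : B y -> wcvg nrm (nbhs y) N (N y) -> wcvg nrm (nbhs y) G (G y).
Proof.
move=> By cN e e0; have [M M0 hM] := (blinear_G By).2.
have nB : \forall y' \near y, B y' by exact: open_nbhs_nbhs.
(* With this tolerance the error term is at most half of the norm of [G y' u]; moved to the left
   side, it leaves the bound [2 * M] for [G y']. The second tolerance cancels this factor and the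
   bound [M] of [G y]. *)
have d0 : 0 < (2 * M)^-1 by rewrite invr_gt0 mulr_gt0.
have e1 : 0 < e / (2 * M * M) by rewrite divr_gt0 ?mulr_gt0.
apply: filterS3 nB (cN _ d0) (cN _ e1) => y' By' N1 N2 v.
have G'M u : nrm (G y' u) <= 2 * M * nrm u.
  have := N1 (G y' u); rewrite (GN By') => h.
  have := hM (N y (G y' u)); rewrite (NG By) => h'.
  have h2 : nrm (N y (G y' u)) <= nrm u + (2 * M)^-1 * nrm (G y' u).
    rewrite -[X in nrm X](subKr u) (le_trans (rnormB _ _)) // lerD2l.
    by rewrite (le_trans _ h).
  have h3 := le_trans h' (ler_wpM2l (ltW M0) h2).
  have E : M * ((2 * M)^-1 * nrm (G y' u)) = nrm (G y' u) / 2.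
    by field; rewrite gt_eqF.
  move: h3; rewrite mulrDr E; lra.
have -> : G y' v - G y v = G y' (- (N y' (G y v) - v)).
  by rewrite opprB blinearB ?(NG By') //; exact: blinear_G.
have := N2 (G y v); rewrite (GN By) => h.
rewrite (le_trans (G'M _)) // rnormN.
have -> : e * nrm v = 2 * M * (e / (2 * M * M) * (M * nrm v)).
  by field; rewrite gt_eqF.
by rewrite ler_pM2l ?mulr_gt0 // (le_trans h) // ler_pM2l.
Qed.

(** By the resolvent identity the quotient of [G] equals - G' Q G, where Q is the quotient of [N]
    and G' is the inverse at the moved point. Continuity of [G] then yields its derivative. *)
Lemma wderiv_inverse mu y A : B y -> blinear A -> wcvg nrm (nbhs y) N (N y) ->
  wderiv nrm N mu y A ->
  wderiv nrm G mu y (fun v => - G y (A (G y v))).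
Proof.
move=> By lA cN dN; have w0 := @rnorm_ge0 R V.
have lG := blinear_G By.
have cG := @wcvg_line _ _ _ mu _ _ (wcvg_inverse By cN).
pose proof (wcvg_comp lA dN lG.2 (wcvg_cst w0 (G y))) as h1.
pose proof (wcvg_comp lG cG (wbounded_comp lA.2 lG.2) h1) as h2.
have lN := blinear_opp (@blinear_id R V).
pose proof (wcvg_comp lN (wcvg_cst w0 (fun v => - v))
  (wbounded_comp lG.2 (wbounded_comp lA.2 lG.2)) h2) as h3.
apply: wcvg_near h3; near=> h; apply/funext => v.
have By' : B (y + h *: delta_mx 0 mu).
  by near: h; apply: cvg_coordinate_line; exact: open_nbhs_nbhs.
have lG' := blinear_G By'.
by rewrite blinearZ // blinearB // NG // GN // -scalerN opprB.
Unshelve. all: by end_near. Qed.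

End Inverse.

Section Smooth.
Variable B : set point.
Hypothesis B_open : open B.

(** Stronger than [Ck] for [op_cvg]: the values and all derivatives are bounded linear, and
    convergence is measured against the norm on the whole space. The rules for products and inverses
    rely on both at every order. *)
Fixpoint Ck_op k f : Prop :=
  (forall y, B y -> blinear (f y) /\ wcvg nrm (nbhs y) f (f y)) /\
  (if k is k'.+1 then
     forall mu, exists2 g, forall y, B y -> wderiv nrm f mu y (g y) & Ck_op k' g
   else True).

Lemma Ck_op_blinear k f y : Ck_op k f -> B y -> blinear (f y).
Proof. by case: k => [|k] [h _] /h []. Qed.

Lemma Ck_op_continuous k f y : Ck_op k f -> B y -> wcvg nrm (nbhs y) f (f y).
Proof. by case: k => [|k] [h _] /h []. Qed.

Lemma Ck_opW k f : Ck_op k.+1 f -> Ck_op k f.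
Proof.
elim: k f => [|k IHk] f [h hd]; split=> // mu.
by have [g fg gk] := hd mu; exists g => //; exact: IHk.
Qed.

(** As [B] is open, agreement on [B] is agreement near each of its points, and the derivatives of
    [f] serve for [g] as they are, without induction. *)
Lemma Ck_op_eq k f g : (forall y, B y -> f y = g y) -> Ck_op k f -> Ck_op k g.
Proof.
move=> fg fk; have nfg y : B y -> \forall y' \near y, f y' = g y'.
  by move=> By; apply: filterS (open_nbhs_nbhs (conj B_open By)).
have h y : B y -> blinear (g y) /\ wcvg nrm (nbhs y) g (g y).
  move=> By; rewrite -(fg _ By); split; first exact: Ck_op_blinear fk By.
  exact: wcvg_near (nfg _ By) (Ck_op_continuous fk By).
case: k fk => [|k] fk; split=> // mu; have [f' df f'k] := fk.2 mu; exists f' => // y By.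
exact: wderiv_near (nfg _ By) (df _ By).
Qed.

Lemma Ck_op_cst k (A : V -> V) : blinear A -> Ck_op k (fun=> A).
Proof.
elim: k A => [|k IHk] A lA;
  (split; [by move=> y _; split=> //; apply: wcvg_cst; exact: rnorm_ge0|]) => //.
move=> mu; exists (fun=> fun=> 0); last exact/IHk/blinear_zero.
by move=> y _; apply: wderiv_cst; exact: rnorm_ge0.
Qed.

Lemma Ck_opD k f g :
  Ck_op k f -> Ck_op k g -> Ck_op k (fun y v => f y v + g y v).
Proof.
have h i f1 f2 y : Ck_op i f1 -> Ck_op i f2 -> B y ->
    blinear (fun v => f1 y v + f2 y v) /\
    wcvg nrm (nbhs y) (fun y v => f1 y v + f2 y v) (fun v => f1 y v + f2 y v).
  move=> k1 k2 By; split.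
    exact: blinear_add (Ck_op_blinear k1 By) (Ck_op_blinear k2 By).
  exact: wcvgD (Ck_op_continuous k1 By) (Ck_op_continuous k2 By).
elim: k f g => [|k IHk] f g fk gk;
  (split; [by move=> y By; exact: h fk gk By|]) => //.
move=> mu; have [f' df f'k] := fk.2 mu; have [g' dg g'k] := gk.2 mu.
exists (fun y v => f' y v + g' y v); last exact: IHk.
by move=> y By; exact: wderivD (df _ By) (dg _ By).
Qed.

Lemma Ck_op_comp k f g : Ck_op k f -> Ck_op k g -> Ck_op k (fun y v => f y (g y v)).
Proof.
have h i f1 f2 y : Ck_op i f1 -> Ck_op i f2 -> B y ->
    blinear (fun v => f1 y (f2 y v)) /\
    wcvg nrm (nbhs y) (fun y v => f1 y (f2 y v)) (fun v => f1 y (f2 y v)).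
  move=> k1 k2 By; have l2 := Ck_op_blinear k2 By.
  split; first exact: blinear_comp (Ck_op_blinear k1 By) l2.
  apply: (wcvg_comp (Ck_op_blinear k1 By) _ l2.2).
    exact: Ck_op_continuous k1 By.
  exact: Ck_op_continuous k2 By.
elim: k f g => [|k IHk] f g fk gk;
  (split; [by move=> y By; exact: h fk gk By|]) => //.
move=> mu; have [f' df f'k] := fk.2 mu; have [g' dg g'k] := gk.2 mu.
exists (fun y v => f' y (g y v) + f y (g' y v)).
  move=> y By; apply: wderiv_comp (df _ By) (dg _ By).
  - exact: rnorm_ge0.
  - exact: Ck_op_blinear fk By.
  - exact: Ck_op_blinear f'k By.
  - exact: (Ck_op_blinear gk By).2.
  - exact: (Ck_op_blinear g'k By).2.
  - exact: Ck_op_continuous gk By.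
by apply: Ck_opD; apply: IHk => //; exact: Ck_opW.
Qed.

Lemma Ck_op_coordinate k (A : V -> V) nu :
  blinear A -> Ck_op k (fun y v => (y 0 nu)%:C%C *: A v).
Proof.
move=> lA; have h y : B y ->
    blinear (fun v => (y 0 nu)%:C%C *: A v) /\
    wcvg nrm (nbhs y) (fun y v => (y 0 nu)%:C%C *: A v)
      (fun v => (y 0 nu)%:C%C *: A v).
  move=> _; split; first exact: blinear_scale.
  by apply: wcvg_scale => //; exact: coord_continuous.
case: k => [|k]; split=> // mu.
exists (fun _ v => ((mu == nu)%:R : R)%:C%C *: A v).
  by move=> y _; exact: wderiv_coordinate.
exact/Ck_op_cst/blinear_scale.
Qed.

Lemma Ck_op_sum k (I : Type) (r : seq I) (f : I -> point -> V -> V) :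
  (forall i, Ck_op k (f i)) -> Ck_op k (fun y v => \sum_(i <- r) f i y v).
Proof.
move=> fk; elim: r => [|i r IHr].
  apply: Ck_op_eq (Ck_op_cst k blinear_zero) => y _.
  by apply/funext => v; rewrite big_nil.
apply: Ck_op_eq (Ck_opD (fk i) IHr) => y _.
by apply/funext => v; rewrite big_cons.
Qed.

(** A bootstrap: the derivative - G N' G contains [G] itself, whose regularity of one order less is
    the induction hypothesis. Continuity of inversion starts the induction. *)
Lemma Ck_op_inverse k (N G : point -> V -> V) :
  (forall y, B y -> blinear (G y)) ->
  (forall y, B y -> cancel (N y) (G y)) ->
  (forall y, B y -> cancel (G y) (N y)) ->
  Ck_op k N -> Ck_op k G.
Proof.
move=> lG NG GN.
have h i y : Ck_op i N -> B y -> blinear (G y) /\ wcvg nrm (nbhs y) G (G y).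
  move=> Ni By; split; first exact: lG.
  apply: (wcvg_inverse B_open lG NG GN By).
  exact: Ck_op_continuous Ni By.
elim: k => [|k IHk] Nk; (split; [by move=> y By; exact: h Nk By|]) => //.
move=> mu; have [N' dN N'k] := Nk.2 mu.
have Gk : Ck_op k G by exact/IHk/Ck_opW.
exists (fun y v => - G y (N' y (G y v))).
  move=> y By; apply: (wderiv_inverse B_open lG NG GN By _ _ (dN _ By)).
  - exact: Ck_op_blinear N'k By.
  - exact: Ck_op_continuous Nk By.
apply: (Ck_op_comp (Ck_op_cst _ (blinear_opp blinear_id))).
exact: Ck_op_comp Gk (Ck_op_comp N'k Gk).
Qed.

(** On the unit ball the weight is at most 1; half of the radius turns the weak inequality into the
    strict one that defines balls. *)
Lemma wcvg_op_cvg {S} (F : set_system S) {FF : Filter F} (f : S -> V -> V) A :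
  wcvg nrm F f A -> op_cvg (f @ F) A.
Proof.
move=> fA P /uniform_nbhs [E [+ EP]]; rewrite -entourage_from_ballE => -[e /= e0 eE].
have eC : e = (complex.Re e)%:C%C by rewrite RRe_real // gtr0_real.
have e2 : 0 < complex.Re e / 2 by rewrite divr_gt0 // -ltcR -eC.
apply: filterS (fA _ e2) => s fs; apply: EP => v /= v1; apply: eE => /=.
rewrite -ball_normE /= eC rnormE ltcR rnormBC (le_lt_trans (fs v)) //.
move: v1; rewrite rnormE -[1]/((1 : R)%:C%C) lecR => v1; nra.
Qed.

Lemma Ck_op_Ck k f : Ck_op k f -> Ck (@op_cvg R V) B k f.
Proof.
elim: k f => [|k IHk] f fk;
  (split; [by move=> y By; exact: (wcvg_op_cvg (Ck_op_continuous fk By))|]) => //.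
move=> mu; have [g fg gk] := fk.2 mu; exists g; last exact: IHk.
by move=> y By; apply: wcvg_op_cvg; exact: fg.
Qed.

End Smooth.
End SmoothOperatorFamilies.

(** * Symmetry of second partial derivatives of real functions *)

Section Clairaut.
Context {R : realType}.
Local Notation point := 'rV[R]_4.
Local Notation dir mu := (delta_mx 0 mu : point).
Implicit Types (f g : point -> R) (y : point) (mu nu : 'I_4).

Definition real_pderiv f mu y (l : R) :=
  h^-1 * (f (y + h *: dir mu) - f y) @[h --> (0 : R)^'] --> l.

Lemma mean_value_line f f' mu y (h : R) : 0 < h ->
  (forall a, 0 <= a <= h ->
     real_pderiv f mu (y + a *: dir mu) (f' (y + a *: dir mu))) ->
  exists2 c, 0 <= c <= h & f (y + h *: dir mu) - f y = f' (y + c *: dir mu) * h.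
Proof.
move=> h0 df; pose g a := f (y + a *: dir mu); pose g' a := f' (y + a *: dir mu).
have dg a : 0 <= a <= h -> is_derive a 1 g (g' a).
  move=> /df; rewrite /real_pderiv => dfa.
  have E : (fun k : R => k^-1 *: ((g \o shift a) (k *: (1 : R)) - g a)) =
    (fun k => k^-1 * (f (y + a *: dir mu + k *: dir mu) - f (y + a *: dir mu))).
    apply/funext => k; rewrite /g /= /shift /= -addrA -scalerDl.
    by rewrite [k *: 1]mulr1 [k + a]addrC.
  have dga : k^-1 *: ((g \o shift a) (k *: (1 : R)) - g a) @[k --> 0^'] --> g' a.
    by rewrite E.
  apply: DeriveDef; first by apply/cvg_ex; exists (g' a).
  exact: cvg_lim dga.
have [||c] := @MVT R g g' 0 h h0.
- by move=> a; rewrite in_itv /= => /andP[a0 ah]; apply: dg; rewrite !ltW.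
- apply: derivable_within_continuous => a; rewrite in_itv /= => a01.
  by have [] := dg a a01.
rewrite in_itv /= => /andP[c0 ch] E; exists c; first by rewrite !ltW.
by move: E; rewrite /g /g' subr0 scale0r addr0.
Qed.

(** The signed sum of [f] over the corners of a square. It is symmetric in the two directions, while
    each order of differentiation gives its own expression for it. *)
Definition second_difference f mu nu y (h : R) :=
  f (y + h *: dir mu + h *: dir nu) - f (y + h *: dir mu)
    - (f (y + h *: dir nu) - f y).

Lemma second_differenceC f mu nu y h :
  second_difference f mu nu y h = second_difference f nu mu y h.
Proof.
rewrite /second_difference [y + h *: dir nu + _]addrAC; ring.
Qed.

Lemma real_pderivB f g mu y a b : real_pderiv f mu y a -> real_pderiv g mu y b ->
  real_pderiv (fun y => f y - g y) mu y (a - b).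
Proof.
move=> fa gb; apply: cvg_trans (cvgB fa gb); apply: near_eq_cvg.
by apply: nearW => h /=; rewrite !fctE; ring.
Qed.

Lemma real_pderiv_shift f mu y v a :
  real_pderiv f mu (y + v) a -> real_pderiv (fun y => f (y + v)) mu y a.
Proof.
apply: cvg_trans; apply: near_eq_cvg.
by apply: nearW => h /=; rewrite addrAC.
Qed.

(** The mean value theorem twice: along [mu] for the increment of [f] in direction [nu], then along
    [nu] for [f1] at the point found. *)
Lemma second_difference_mean_value f f1 f12 mu nu y (h : R) : 0 < h ->
  (forall a b, 0 <= a <= h -> 0 <= b <= h ->
     let z := y + a *: dir mu + b *: dir nu in
     real_pderiv f mu z (f1 z) /\ real_pderiv f1 nu z (f12 z)) ->
  exists2 c, (0 <= c.1 <= h) && (0 <= c.2 <= h) &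
    second_difference f mu nu y h = f12 (y + c.1 *: dir mu + c.2 *: dir nu) * h ^+ 2.
Proof.
move=> h0 df; have h00 : 0 <= h <= h by rewrite lexx ltW.
pose g z := f (z + h *: dir nu) - f z.
pose g1 z := f1 (z + h *: dir nu) - f1 z.
have [a a01|c c01 Ec] := @mean_value_line g g1 mu y h h0.
  apply: real_pderivB; last first.
    by have := (df a 0 a01 _).1; rewrite /= scale0r addr0 lexx ltW //; apply.
  by apply: real_pderiv_shift; exact: (df a h a01 h00).1.
have [a a01|d d01 Ed] := @mean_value_line f1 f12 nu (y + c *: dir mu) h h0.
  exact: (df c a c01 a01).2.
exists (c, d); first by rewrite /= c01.
by rewrite /second_difference -/(g _) -/(g y) Ec /g1 Ed expr2 mulrA.
Qed.

Lemma near_square mu nu y (P : set point) : nbhs y P ->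
  exists2 h : R, 0 < h & forall a b, 0 <= a <= h -> 0 <= b <= h ->
    P (y + a *: dir mu + b *: dir nu).
Proof.
move=> /nbhs_ballP[e /= e0 eP]; pose K := `|dir mu| + `|dir nu| + 1.
have K0 : 0 < K by rewrite ltr_wpDl // addr_ge0.
exists (e / (2 * K)); first by rewrite divr_gt0 // mulr_gt0.
move=> a b /andP[a0 ae] /andP[b0 be]; apply: eP; rewrite -ball_normE /=.
rewrite -addrA opprD addrA subrr add0r normrN.
apply: le_lt_trans (ler_normD _ _) _; rewrite !normrZ !ger0_norm //.
have : a * `|dir mu| + b * `|dir nu| <= e / (2 * K) * (`|dir mu| + `|dir nu|).
  by rewrite mulrDr lerD // ler_wpM2r.
move=> /le_lt_trans; apply.
have E : e = e / (2 * K) * (2 * K) by field; rewrite gt_eqF.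
rewrite [ltRHS]E ltr_pM2l; last by rewrite divr_gt0 // mulr_gt0.
by rewrite /K; have := normr_ge0 (dir mu); have := normr_ge0 (dir nu); lra.
Qed.

(** Dividing the symmetric second difference by the square of [h] makes a value of [f12] equal to a
    value of [f21], at two points of one small square. Both are within e / 2 of the values at
    [y]. *)
Lemma clairaut (B : set point) f f1 f2 f12 f21 mu nu y : open B -> B y ->
  (forall z, B z -> real_pderiv f mu z (f1 z)) ->
  (forall z, B z -> real_pderiv f nu z (f2 z)) ->
  (forall z, B z -> real_pderiv f1 nu z (f12 z)) ->
  (forall z, B z -> real_pderiv f2 mu z (f21 z)) ->
  f12 z @[z --> y] --> f12 y -> f21 z @[z --> y] --> f21 y ->
  f12 y = f21 y.
Proof.
move=> oB By d1 d2 d12 d21 c12 c21; apply/eqP; rewrite -subr_eq0 -normr_le0.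
apply/ler_addgt0Pr => e e0; rewrite add0r.
have e2 : 0 < e / 2 by rewrite divr_gt0.
have nB : \forall z \near y, B z by exact: open_nbhs_nbhs.
move/cvgrPdist_le : c12 => /(_ _ e2) c12; move/cvgrPdist_le : c21 => /(_ _ e2) c21.
have [h h0 hP] := near_square mu nu (filterI nB (filterI c12 c21)).
have hP' a b : 0 <= a <= h -> 0 <= b <= h ->
    let z := y + a *: dir nu + b *: dir mu in
    [/\ B z, `|f12 y - f12 z| <= e / 2 & `|f21 y - f21 z| <= e / 2].
  by move=> ha hb /=; rewrite addrAC; have [? [? ?]] := hP b a hb ha.
have [|[c d] /= /andP[c01 d01] E1] :=
    @second_difference_mean_value f f1 f12 mu nu y h h0.
  by move=> a b ha hb z; have [Bz _] := hP a b ha hb; split; [exact: d1|exact: d12].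
have [|[c' d'] /= /andP[c01' d01'] E2] :=
    @second_difference_mean_value f f2 f21 nu mu y h h0.
  by move=> a b ha hb z; have [Bz _ _] := hP' a b ha hb; split; [exact: d2|exact: d21].
move: E2; rewrite -second_differenceC E1 => /(mulIf _) E.
have {}E := E (lt0r_neq0 (exprn_gt0 _ h0)).
have [_ [ h1 _]] := hP c d c01 d01; have [_ _ h2] := hP' c' d' c01' d01'.
have -> : f12 y - f21 y = (f12 y - f12 (y + c *: dir mu + d *: dir nu)) -
   (f21 y - f21 (y + c' *: dir nu + d' *: dir mu)) by rewrite E; ring.
by apply: le_trans (ler_normB _ _) _; rewrite [leRHS](splitr e) lerD.
Qed.

End Clairaut.

(** * Transfer to vector-valued maps by real functionals *)

Section BoundedFunctionals.
Context {R : realType} {V : normedModType R[i]}.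
Local Notation point := 'rV[R]_4.

(** Real linearity, because the functionals in view are real parts of inner products and difference
    quotients have real coefficients. *)
Definition bounded_functional (phi : V -> R) :=
  [/\ forall u v, phi (u - v) = phi u - phi v,
      forall (r : R) v, phi (r%:C%C *: v) = r * phi v
    & exists2 M : R, 0 < M & forall v, `|phi v| <= M * rnorm v].

Lemma cvg_functional phi {S} (F : set_system S) {FF : Filter F} (f : S -> V) l :
  bounded_functional phi -> f @ F --> l -> (fun s => phi (f s)) @ F --> phi l.
Proof.
case=> phiB _ [M M0 hM] /cvg_rnormP fl; apply/cvgrPdistC_le => e e0.
have e1 : 0 < e / M by rewrite divr_gt0.
apply: filterS (fl _ e1) => s fs; rewrite -phiB (le_trans (hM _)) //.
by rewrite mulrC -ler_pdivlMr.
Qed.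

Lemma clairaut_functional phi (B : set point) (s s1 s2 s12 s21 : point -> V) mu nu y :
  bounded_functional phi -> open B -> B y ->
  (forall z, B z -> diff_quotient s mu z h @[h --> (0 : R)^'] --> s1 z) ->
  (forall z, B z -> diff_quotient s nu z h @[h --> (0 : R)^'] --> s2 z) ->
  (forall z, B z -> diff_quotient s1 nu z h @[h --> (0 : R)^'] --> s12 z) ->
  (forall z, B z -> diff_quotient s2 mu z h @[h --> (0 : R)^'] --> s21 z) ->
  s12 z @[z --> y] --> s12 y -> s21 z @[z --> y] --> s21 y ->
  phi (s12 y) = phi (s21 y).
Proof.
move=> hphi oB By d1 d2 d12 d21 c12 c21.
have dphi (f g : point -> V) i :
    (forall z, B z -> diff_quotient f i z h @[h --> (0 : R)^'] --> g z) ->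
    forall z, B z -> real_pderiv (fun z => phi (f z)) i z (phi (g z)).
  move=> fg z /fg fgz; have [phiB phiZ _] := hphi.
  apply: cvg_trans (cvg_functional hphi fgz); apply: near_eq_cvg.
  by apply: nearW => h; rewrite /diff_quotient phiZ phiB.
apply: (clairaut oB By (dphi _ _ _ d1) (dphi _ _ _ d2) (dphi _ _ _ d12)
  (dphi _ _ _ d21)).
  exact: (cvg_functional hphi c12).
exact: (cvg_functional hphi c21).
Qed.

End BoundedFunctionals.

(** * Inner products as functionals, and symmetry of second derivatives of spinors *)

Section HilbertNorm.
Context {R : realType} {H : completeNormedModType R[i]} {dot : {dot H for Num.conj}}.
Hypothesis norm_dot : hilbert_norm dot.
Implicit Types (u v : H) (w : spinor H).

Lemma sqr_rnorm_dot v : rnorm v ^+ 2 = complex.Re (dot v v).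
Proof. by rewrite -norm_dot rnormE -rmorphXn. Qed.

Lemma Re_dot_polarization u v :
  rnorm (v + u) ^+ 2 = rnorm v ^+ 2 + rnorm u ^+ 2 + complex.Re (dot v u) *+ 2.
Proof.
rewrite !sqr_rnorm_dot dnormD /=.
by case: (dot v v) (dot u u) (dot v u) => [a b] [c d] [e f] /=.
Qed.

(** Cauchy-Schwarz read off from the triangle inequality: square it, expand the left side by
    polarization and cancel the squares. *)
Lemma Re_dot_le u v : complex.Re (dot v u) <= rnorm v * rnorm u.
Proof.
have := Re_dot_polarization u v; have := rnormD v u.
have := rnorm_ge0 (v + u); have := rnorm_ge0 v; have := rnorm_ge0 u.
nra.
Qed.

Lemma norm_Re_dot_le u v : `|complex.Re (dot v u)| <= rnorm v * rnorm u.
Proof.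
rewrite ler_norml Re_dot_le andbT.
have := Re_dot_le u (- v); rewrite rnormN linearNl /=.
by case: (dot v u) => a b /= ?; rewrite lerNl.
Qed.

Lemma Re_dot_functional u : bounded_functional (fun v => complex.Re (dot v u)).
Proof.
split=> [v1 v2|r v|].
- by rewrite linearBl /=; case: (dot v1 u) (dot v2 u) => [a b] [c d].
- by rewrite linearZl_LR /=; case: (dot v u) => [a b] /=; rewrite mul0r subr0.
exists (rnorm u + 1); first by rewrite ltr_wpDl ?rnorm_ge0.
move=> v; rewrite (le_trans (norm_Re_dot_le _ _)) // mulrC ler_wpM2r ?rnorm_ge0 //.
by rewrite lerDl.
Qed.

Lemma rnorm_spinor w : rnorm w = Num.max (rnorm w.1) (rnorm w.2).
Proof.
have h : `|w| = Num.max `|w.1| `|w.2| by [].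
rewrite /rnorm h; case: (leP (rnorm w.1) (rnorm w.2)) => c.
  by rewrite max_r // !rnormE lecR.
by rewrite max_l // !rnormE lecR ltW.
Qed.

(** [p] stands for either coordinate projection; both are linear and contract the maximum norm. *)
Lemma spinor_functional (p : spinor H -> H) u :
  (forall (a : R[i]) w z, p (a *: w - z) = a *: p w - p z) ->
  (forall w, rnorm (p w) <= rnorm w) ->
  bounded_functional (fun w => complex.Re (dot (p w) u)).
Proof.
have [dB dZ [M M0 hM]] := Re_dot_functional u.
move=> pB pn; have p0 : p 0 = 0 by have := pB 1 0 0; rewrite !scale1r !subrr.
split=> [w z|r w|].
- by have := pB 1 w z; rewrite !scale1r => ->; exact: dB.
- by have := pB r%:C%C w 0; rewrite p0 !subr0 => ->; exact: dZ.
by exists M => // w; rewrite (le_trans (hM _)) // ler_pM2l.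
Qed.

(** In each component the test vector is the difference of the two mixed derivatives; the scalar
    result says that its inner product with itself has real part zero. *)
Lemma clairaut_spinor (B : set 'rV[R]_4)
    (s s1 s2 s12 s21 : 'rV[R]_4 -> spinor H) mu nu y :
  open B -> B y ->
  (forall z, B z -> diff_quotient s mu z h @[h --> (0 : R)^'] --> s1 z) ->
  (forall z, B z -> diff_quotient s nu z h @[h --> (0 : R)^'] --> s2 z) ->
  (forall z, B z -> diff_quotient s1 nu z h @[h --> (0 : R)^'] --> s12 z) ->
  (forall z, B z -> diff_quotient s2 mu z h @[h --> (0 : R)^'] --> s21 z) ->
  s12 z @[z --> y] --> s12 y -> s21 z @[z --> y] --> s21 y ->
  s12 y = s21 y.
Proof.
move=> oB By d1 d2 d12 d21 c12 c21.
have key (p : spinor H -> H) :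
    (forall (a : R[i]) w z, p (a *: w - z) = a *: p w - p z) ->
    (forall w, rnorm (p w) <= rnorm w) -> p (s12 y) = p (s21 y).
  move=> pB pn; apply/eqP; rewrite -subr_eq0; apply/eqP/rnorm_eq0.
  set v := p _ - p _.
  have := clairaut_functional (spinor_functional v pB pn) oB By d1 d2 d12 d21 c12 c21.
  move=> E; apply/eqP; rewrite -sqrf_eq0 sqr_rnorm_dot {1}/v linearBl /=.
  by move: E; case: (dot _ v) (dot _ v) => [a b] [c d] /= ->; rewrite subrr.
have E1 : (s12 y).1 = (s21 y).1.
  by apply: (key fst) => // w; rewrite rnorm_spinor le_max lexx.
have E2 : (s12 y).2 = (s21 y).2.
  by apply: (key snd) => // w; rewrite rnorm_spinor le_max lexx orbT.
by move: E1 E2; case: (s12 y) (s21 y) => [a b] [c d] /= -> ->.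
Qed.

End HilbertNorm.

(** * The Hodge star on 2-forms in coordinates *)

Section HodgeStar.

Definition minor2 (K : pzRingType) (f : nat -> nat -> K) (i j a b : nat) : K :=
  f i a * f j b - f i b * f j a.

Definition nat_minor (K : pzRingType) (f : nat -> nat -> K) (j : nat) :=
  fun i k => f i.+1 (bump j k).

Lemma expand_det_nat_mx (K : comNzRingType) n (f : nat -> nat -> K) :
  \det (\matrix_(i < n.+1, j < n.+1) f i j) =
  \sum_(j < n.+1)
     f 0%N j * ((-1) ^+ j * \det (\matrix_(i < n, k < n) nat_minor f j i k)).
Proof.
rewrite (expand_det_row _ ord0); apply: eq_bigr => j _; rewrite mxE; congr (_ * _).
rewrite /cofactor add0n; congr (_ * \det _); apply/matrixP => i k.
by rewrite !mxE /= /bump.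
Qed.

(** Laplace expansion along the first two rows, with complementary 2 by 2 minors. As an explicit
    polynomial it leaves identities of the Levi-Civita symbol to [ring]. *)
Lemma det_mx4 (K : comNzRingType) (f : nat -> nat -> K) :
  \det (\matrix_(i < 4, j < 4) f i j) =
    minor2 f 0 1 0 1 * minor2 f 2 3 2 3 - minor2 f 0 1 0 2 * minor2 f 2 3 1 3
    + minor2 f 0 1 0 3 * minor2 f 2 3 1 2 + minor2 f 0 1 1 2 * minor2 f 2 3 0 3
    - minor2 f 0 1 1 3 * minor2 f 2 3 0 2 + minor2 f 0 1 2 3 * minor2 f 2 3 0 1.
Proof.
have d2 (g : nat -> nat -> K) :
    \det (\matrix_(i < 2, j < 2) g i j) = minor2 g 0 1 0 1.
  rewrite expand_det_nat_mx !big_ord_recl big_ord0 !det_mx11 !mxE.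
  by rewrite /nat_minor /= /bump /= /minor2; ring.
have d3 (g : nat -> nat -> K) : \det (\matrix_(i < 3, j < 3) g i j) =
    g 0%N 0%N * minor2 g 1 2 1 2 - g 0%N 1%N * minor2 g 1 2 0 2
    + g 0%N 2%N * minor2 g 1 2 0 1.
  rewrite (@expand_det_nat_mx K 2 g) !big_ord_recl big_ord0 !d2.
  by rewrite /nat_minor /= /bump /= /minor2; ring.
rewrite (@expand_det_nat_mx K 3 f) !big_ord_recl big_ord0 !d3.
by rewrite /nat_minor /= /bump /= /minor2; ring.
Qed.

Lemma sum_pair_delta (K : pzRingType) (W : lmodType K) (I : finType)
    (F : I -> I -> W) a b :
  \sum_r \sum_s ((r == a) && (s == b))%:R *: F r s = F a b.
Proof.
rewrite (bigD1 a) //= (bigD1 b) //= !eqxx scale1r big1 => [|s /negPf ->]; last first.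
  by rewrite scale0r.
rewrite addr0 big1 ?addr0 // => r /negPf ra; rewrite big1 // => s _.
by rewrite ra scale0r.
Qed.

Context {K : numFieldType} {W : lmodType K}.
Implicit Types (mu nu rho sigma : 'I_4) (F : 'I_4 -> 'I_4 -> W).

Lemma levi_civitaE mu nu rho sigma :
  let f i j : K := (nth 0 [:: mu; nu; rho; sigma] i == j :> nat)%:R in
  levi_civita K mu nu rho sigma =
    minor2 f 0 1 0 1 * minor2 f 2 3 2 3 - minor2 f 0 1 0 2 * minor2 f 2 3 1 3
    + minor2 f 0 1 0 3 * minor2 f 2 3 1 2 + minor2 f 0 1 1 2 * minor2 f 2 3 0 3
    - minor2 f 0 1 1 3 * minor2 f 2 3 0 2 + minor2 f 0 1 2 3 * minor2 f 2 3 0 1.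
Proof.
move=> f; rewrite -det_mx4; congr (\det _); apply/matrixP => i j.
by rewrite !mxE (tnth_nth 0).
Qed.

Lemma levi_civita_swap mu nu rho sigma :
  levi_civita K nu mu rho sigma = - levi_civita K mu nu rho sigma.
Proof. by rewrite !levi_civitaE /minor2 /=; ring. Qed.

Lemma levi_civita_diag mu rho sigma : levi_civita K mu mu rho sigma = 0.
Proof. by rewrite !levi_civitaE /minor2 /=; ring. Qed.

Lemma hodge_swap F mu nu : hodge F nu mu = - hodge F mu nu.
Proof.
rewrite /hodge -scalerN; congr (_ *: _).
rewrite -sumrN; apply: eq_bigr => rho _; rewrite -sumrN; apply: eq_bigr => sigma _.
by rewrite levi_civita_swap scaleNr.
Qed.

Lemma hodge_diag F mu : hodge F mu mu = 0.
Proof.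
rewrite /hodge !big1 ?scaler0 // => rho _; rewrite big1 // => sigma _.
by rewrite levi_civita_diag scale0r.
Qed.

Lemma two_form_diag F mu : two_form F -> F mu mu = 0.
Proof.
move=> /(_ mu mu) /eqP; rewrite -addr_eq0 -mulr2n -scaler_nat scaler_eq0.
by rewrite pnatr_eq0 => /eqP.
Qed.

(** For the given first two indices the symbol is 1 at one ordered pair, -1 at the reversed pair and
    0 elsewhere. By antisymmetry of [F] the two terms agree, which cancels the factor 1/2. *)
Lemma hodge_pair F mu nu rho sigma : two_form F ->
  (forall r s, levi_civita K mu nu r s =
     ((r == rho) && (s == sigma))%:R - ((r == sigma) && (s == rho))%:R) ->
  hodge F mu nu = F rho sigma.
Proof.
move=> F2 E.
rewrite /hodge; under eq_bigr do under eq_bigr do rewrite E scalerBl.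
under eq_bigr do rewrite sumrB.
rewrite sumrB !sum_pair_delta (F2 sigma rho) opprK.
have -> : F rho sigma + F rho sigma = 2 *: F rho sigma by rewrite scaler_nat mulr2n.
by rewrite scalerA mulVf ?scale1r // pnatr_eq0.
Qed.

Lemma ord4P (P : 'I_4 -> Prop) : P 0 -> P 1 -> P 2 -> P 3 -> forall mu, P mu.
Proof.
move=> P0 P1 P2 P3 [[|[|[|[|//]]]] h].
- by rewrite (_ : Ordinal h = 0) //; apply: val_inj.
- by rewrite (_ : Ordinal h = 1) //; apply: val_inj.
- by rewrite (_ : Ordinal h = 2) //; apply: val_inj.
- by rewrite (_ : Ordinal h = 3) //; apply: val_inj.
Qed.

(** Writing [3 1] rather than [1 3] makes 0123, 0231 and 0312 even permutations, so that no sign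
    appears. *)
Lemma hodge_two_form F : two_form F ->
  [/\ hodge F 0 1 = F 2 3, hodge F 0 2 = F 3 1 & hodge F 0 3 = F 1 2] /\
  [/\ hodge F 2 3 = F 0 1, hodge F 3 1 = F 0 2 & hodge F 1 2 = F 0 3].
Proof.
move=> F2; split; split; apply: hodge_pair F2 _.
- by apply: ord4P; apply: ord4P; rewrite levi_civitaE /minor2 /=; ring.
- by apply: ord4P; apply: ord4P; rewrite levi_civitaE /minor2 /=; ring.
- by apply: ord4P; apply: ord4P; rewrite levi_civitaE /minor2 /=; ring.
- by apply: ord4P; apply: ord4P; rewrite levi_civitaE /minor2 /=; ring.
- by apply: ord4P; apply: ord4P; rewrite levi_civitaE /minor2 /=; ring.
- by apply: ord4P; apply: ord4P; rewrite levi_civitaE /minor2 /=; ring.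
Qed.

Lemma two_form_ind (P : 'I_4 -> 'I_4 -> Prop) :
  (forall mu nu, P mu nu -> P nu mu) -> (forall mu, P mu mu) ->
  P 0 1 -> P 0 2 -> P 0 3 -> P 2 3 -> P 3 1 -> P 1 2 -> forall mu nu, P mu nu.
Proof.
move=> PC Pd P01 P02 P03 P23 P31 P12.
by apply: ord4P; apply: ord4P => //; apply: PC.
Qed.

Lemma two_form_asd F : two_form F ->
  F 0 1 + F 2 3 = 0 -> F 0 2 + F 3 1 = 0 -> F 0 3 + F 1 2 = 0 -> anti_self_dual F.
Proof.
move=> F2 E1 E2 E3; have [[h1 h2 h3] [h4 h5 h6]] := hodge_two_form F2.
apply: two_form_ind => [mu nu E|mu|||||| ].
- by rewrite hodge_swap E (F2 nu mu) opprK.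
- by rewrite hodge_diag two_form_diag ?oppr0.
- by rewrite h1; apply/eqP; rewrite -addr_eq0 addrC E1.
- by rewrite h2; apply/eqP; rewrite -addr_eq0 addrC E2.
- by rewrite h3; apply/eqP; rewrite -addr_eq0 addrC E3.
- by rewrite h4; apply/eqP; rewrite -addr_eq0 E1.
- by rewrite h5; apply/eqP; rewrite -addr_eq0 E2.
- by rewrite h6; apply/eqP; rewrite -addr_eq0 E3.
Qed.

Lemma two_form_sd F : two_form F ->
  F 0 1 = F 2 3 -> F 0 2 = F 3 1 -> F 0 3 = F 1 2 -> self_dual F.
Proof.
move=> F2 E1 E2 E3; have [[h1 h2 h3] [h4 h5 h6]] := hodge_two_form F2.
apply: two_form_ind => [mu nu E|mu|||||| ]; rewrite ?h1 ?h2 ?h3 ?h4 ?h5 ?h6 //.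
- by rewrite hodge_swap E (F2 nu mu).
- by rewrite hodge_diag two_form_diag.
Qed.

End HodgeStar.

(** * Quadratic relations between Clifford matrices from the chirality convention *)

Section CliffordRelations.
Context {R : realType}.
Local Notation C := R[i].

(** The coefficients of the 2-form dx_a /\ dx_b. *)
Definition elementary_form (a b : 'I_4) (mu nu : 'I_4) : R^o :=
  ((mu == a) && (nu == b))%:R - ((mu == b) && (nu == a))%:R.

Lemma two_form_elementary a b : two_form (elementary_form a b).
Proof. by move=> mu nu; rewrite /elementary_form opprB [(nu == b) && _]andbC
  [(nu == a) && _]andbC. Qed.

Lemma clifford_elementary_form (c c' : 'I_4 -> 'M[C]_2) a b :
  clifford_form c c' (elementary_form a b) =
  2^-1 *: (c' a *m c b - c' b *m c a).
Proof.
rewrite /clifford_form; congr (_ *: _).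
under eq_bigr => i _ do under eq_bigr => j _ do
  rewrite rmorphB !rmorph_nat scalerBl.
under eq_bigr do rewrite sumrB.
by rewrite sumrB !sum_pair_delta.
Qed.

Lemma clifford_formD (c c' : 'I_4 -> 'M[C]_2) (w w' : 'I_4 -> 'I_4 -> R^o) :
  clifford_form c c' (fun mu nu => w mu nu + w' mu nu) =
  clifford_form c c' w + clifford_form c c' w'.
Proof.
rewrite /clifford_form -scalerDr -big_split; congr (_ *: _); apply: eq_bigr => i _.
by rewrite -big_split; apply: eq_bigr => j _; rewrite rmorphD scalerDl.
Qed.

Lemma two_formD (w w' : 'I_4 -> 'I_4 -> R^o) : two_form w -> two_form w' ->
  two_form (fun mu nu => w mu nu + w' mu nu).
Proof. by move=> h h' mu nu; rewrite h h' opprD. Qed.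

Section Relations.
Variables (cp cm : 'I_4 -> 'M[C]_2).
Hypothesis clifford_cpm : clifford_multiplication cp cm.

Lemma cmcp_diag mu : cm mu *m cp mu = - 1%:M.
Proof.
have [_ h _ _ _] := clifford_cpm; have := h mu mu.
rewrite eqxx mulr1 -mulr2n -scaler_nat => /(congr1 (fun M => 2^-1 *: M)).
rewrite scalerA mulVf ?pnatr_eq0 // scale1r => ->.
rewrite scale_scalar_mx mulrN mulVf ?pnatr_eq0 //.
exact: raddfN.
Qed.

Lemma cmcpC mu nu : mu != nu -> cm nu *m cp mu = - (cm mu *m cp nu).
Proof.
have [_ h _ _ _] := clifford_cpm => /negPf mn; have := h mu nu.
by rewrite mn mulr0 raddf0 addrC => /eqP; rewrite addr_eq0 => /eqP.
Qed.

Lemma half_scale_inj (W : lmodType C) (a b : W) : 2^-1 *: a = 2^-1 *: b -> a = b.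
Proof. by apply: scalerI; rewrite invr_eq0 pnatr_eq0. Qed.

(** The reversed indices [d c] put a minus sign on the second form, so the test form is dx_a /\ dx_b
    - dx_c /\ dx_d. Anticommutation merges the two terms of each antisymmetrized product. *)
Lemma cmcp_asd a b c d : a != b -> c != d ->
  anti_self_dual (fun mu nu => elementary_form a b mu nu + elementary_form d c mu nu) ->
  cm a *m cp b = cm c *m cp d.
Proof.
move=> ab cd asd; have [_ _ _ h _] := clifford_cpm.
have := h _ (two_formD (two_form_elementary a b) (two_form_elementary d c)) asd.
rewrite clifford_formD !clifford_elementary_form -scalerDr.
rewrite (cmcpC ab) (cmcpC cd) opprK -opprD -(scaler0 _ 2^-1) => /half_scale_inj.
rewrite -!mulr2n -mulrnBl -scaler_nat => /eqP.
by rewrite scaler_eq0 pnatr_eq0 subr_eq0 => /eqP.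
Qed.

(** The antisymmetrized products are kept, since they are the matrices that occur in the
    curvature. *)
Lemma cpcm_sd a b c d :
  self_dual (fun mu nu => elementary_form a b mu nu + elementary_form c d mu nu) ->
  (cp a *m cm b - cp b *m cm a) + (cp c *m cm d - cp d *m cm c) = 0.
Proof.
move=> sd; have [_ _ _ _ h] := clifford_cpm.
have := h _ (two_formD (two_form_elementary a b) (two_form_elementary c d)) sd.
rewrite clifford_formD !clifford_elementary_form -scalerDr => E.
by apply: half_scale_inj; rewrite E scaler0.
Qed.

Lemma cmcp_relations :
  [/\ cm 0 *m cp 1 = cm 2 *m cp 3, cm 0 *m cp 2 = cm 3 *m cp 1
    & cm 0 *m cp 3 = cm 1 *m cp 2].
Proof.
split; apply: cmcp_asd => //; apply: two_form_asd;
  try (by apply: two_formD; apply: two_form_elementary);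
  rewrite /elementary_form /=; ring.
Qed.

Lemma cpcm_relations :
  [/\ (cp 0 *m cm 1 - cp 1 *m cm 0) + (cp 2 *m cm 3 - cp 3 *m cm 2) = 0,
      (cp 0 *m cm 2 - cp 2 *m cm 0) + (cp 3 *m cm 1 - cp 1 *m cm 3) = 0
    & (cp 0 *m cm 3 - cp 3 *m cm 0) + (cp 1 *m cm 2 - cp 2 *m cm 1) = 0].
Proof.
split; apply: cpcm_sd; apply: two_form_sd;
  try (by apply: two_formD; apply: two_form_elementary);
  rewrite /elementary_form /=; ring.
Qed.

End Relations.

Lemma sum_I4 (W : zmodType) (f : 'I_4 -> W) : \sum_mu f mu = f 0 + f 1 + f 2 + f 3.
Proof.
rewrite !big_ord_recl big_ord0 addr0 !addrA.
by congr (_ + f _ + f _ + f _); apply: val_inj.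
Qed.

Lemma sum_I4_pairs (W : zmodType) (f : 'I_4 -> 'I_4 -> W) :
  \sum_mu \sum_nu f mu nu = \sum_mu f mu mu
    + (f 0 1 + f 1 0 + f 2 3 + f 3 2) + (f 0 2 + f 2 0 + f 3 1 + f 1 3)
    + (f 0 3 + f 3 0 + f 1 2 + f 2 1).
Proof.
rewrite !sum_I4 !addrA.
by rewrite [LHS](ACl (1*6*11*16*2*5*12*15*3*9*14*8*4*13*7*10)).
Qed.

(** Off the diagonal [q] is antisymmetric and self-dual, while the antisymmetric part of [a] is
    anti-self-dual. Their contraction vanishes and the diagonal remains. *)
Lemma contract_asd_commutators (W : lmodType C) (q : 'I_4 -> 'I_4 -> C)
    (a : 'I_4 -> 'I_4 -> W) (d : C) :
  (forall mu, q mu mu = d) -> (forall mu nu, mu != nu -> q nu mu = - q mu nu) ->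
  q 0 1 = q 2 3 -> q 0 2 = q 3 1 -> q 0 3 = q 1 2 ->
  (a 0 1 - a 1 0) + (a 2 3 - a 3 2) = 0 ->
  (a 0 2 - a 2 0) + (a 3 1 - a 1 3) = 0 ->
  (a 0 3 - a 3 0) + (a 1 2 - a 2 1) = 0 ->
  \sum_mu \sum_nu q mu nu *: a mu nu = d *: \sum_mu a mu mu.
Proof.
move=> qd qC q1 q2 q3 a1 a2 a3; rewrite sum_I4_pairs.
have key m n r s : m != n -> r != s -> q m n = q r s ->
    a m n - a n m + (a r s - a s r) = 0 ->
    q m n *: a m n + q n m *: a n m + q r s *: a r s + q s r *: a s r = 0.
  move=> mn rs E; rewrite (qC _ _ mn) (qC _ _ rs) -E !scaleNr -!scalerN -!scalerDr.
  by rewrite addrA => ->; rewrite scaler0.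
rewrite !key // !addr0 scaler_sumr.
by apply: eq_bigr => mu _; rewrite qd.
Qed.

End CliffordRelations.

(** * Operators on spinors built from an operator on [H] and a 2 by 2 matrix *)

Section TensorOperators.
Context {R : realType} {H : completeNormedModType R[i]}.
Local Notation C := R[i].
Local Notation V := (spinor H).
Implicit Types (A : H -> H) (c : 'M[C]_2) (w z : V).

Lemma ord2P (P : 'I_2 -> Prop) : P 0 -> P 1 -> forall i, P i.
Proof.
move=> P0 P1 [[|[|//]] h].
- by rewrite (_ : Ordinal h = 0) //; apply: val_inj.
- by rewrite (_ : Ordinal h = 1) //; apply: val_inj.
Qed.

Lemma sum_I2 (W : zmodType) (f : 'I_2 -> W) : \sum_i f i = f 0 + f 1.
Proof.
by rewrite !big_ord_recl big_ord0 addr0; congr (_ + f _); apply: val_inj.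
Qed.

Lemma tensor_op_comp A A' c c' w : blinear A ->
  tensor_op A c (tensor_op A' c' w) = tensor_op (fun v => A (A' v)) (c *m c') w.
Proof.
move=> lA; rewrite /tensor_op /=; congr (_, _);
by rewrite !mxE !sum_I2 !(blinearD _ _ lA) !(blinearZ _ _ lA) !scalerDr !scalerA
  !scalerDl addrACA.
Qed.

Lemma tensor_op_eq A A' c w :
  (forall v, A v = A' v) -> tensor_op A c w = tensor_op A' c w.
Proof. by move=> E; rewrite /tensor_op !E. Qed.

Lemma tensor_opDr A c c' w : tensor_op A (c + c') w = tensor_op A c w + tensor_op A c' w.
Proof.
by rewrite /tensor_op !mxE !scalerDl; congr (_, _); rewrite /= addrACA.
Qed.

Lemma tensor_opZr A c (a : C) w : tensor_op A (a *: c) w = a *: tensor_op A c w.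
Proof. by rewrite /tensor_op !mxE -!scalerA; congr (_, _); rewrite /= scalerDr. Qed.

Lemma tensor_opNr A c w : tensor_op A (- c) w = - tensor_op A c w.
Proof. by rewrite /tensor_op !mxE !scaleNr -!opprD. Qed.

Lemma tensor_opZl A c (a : C) w :
  tensor_op (fun v => a *: A v) c w = a *: tensor_op A c w.
Proof.
by rewrite /tensor_op; congr (_, _); rewrite /= scalerDr !scalerA;
  congr (_ *: _ + _ *: _); rewrite mulrC.
Qed.

Lemma tensor_op1 A w : tensor_op A 1%:M w = (A w.1, A w.2).
Proof. by rewrite /tensor_op !mxE /= !scale1r !scale0r addr0 add0r. Qed.

Lemma tensor_op_id w : tensor_op id 1%:M w = w.
Proof. by rewrite tensor_op1; case: w. Qed.

Lemma blinear_tensor_op A c : blinear A -> blinear (tensor_op A c : V -> V).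
Proof.
move=> lA; split.
  move=> a w z; rewrite /tensor_op; congr (_, _); rewrite /= !lA.1 !scalerDr;
  by rewrite addrACA !scalerA; congr (_ *: _ + _ *: _ + _); rewrite mulrC.
(* [K] dominates each row sum of moduli of entries; the 1 in [1 + K] keeps the bound positive when
   [c] is zero. *)
have [M M0 hM] := lA.2; pose K := \sum_i \sum_j complex.Re `|c i j|.
have K0 i : 0 <= \sum_j complex.Re `|c i j|.
  by apply: sumr_ge0 => j _; exact: Re_norm_ge0.
have KK i : \sum_j complex.Re `|c i j| <= K.
  rewrite /K [leRHS]sum_I2; move: i; apply: ord2P; first by rewrite lerDl.
  by rewrite lerDr.
have key i w : rnorm (c i 0 *: A w.1 + c i 1 *: A w.2) <= (1 + K) * M * rnorm w.
  apply: le_trans (rnormD _ _) _; rewrite !rnormZ.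
  have h1 : rnorm (A w.1) <= M * rnorm w.
    by rewrite (le_trans (hM _)) // ler_pM2l // rnorm_spinor le_max lexx.
  have h2 : rnorm (A w.2) <= M * rnorm w.
    by rewrite (le_trans (hM _)) // ler_pM2l // rnorm_spinor le_max lexx orbT.
  have := KK i; rewrite sum_I2 => KKi.
  have w0 := rnorm_ge0 w; have Mw : 0 <= M * rnorm w by rewrite mulr_ge0 // ltW.
  rewrite -mulrA; apply: le_trans (lerD (ler_wpM2l (Re_norm_ge0 _) h1)
    (ler_wpM2l (Re_norm_ge0 _) h2)) _.
  by rewrite -mulrDl ler_wpM2r // (le_trans KKi) // lerDr.
exists ((1 + K) * M).
  rewrite mulr_gt0 // ltr_pwDl // /K; exact: sumr_ge0.
by move=> w; rewrite rnorm_spinor ge_max !key.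
Qed.

Variable dot : {dot H for Num.conj}.

Lemma tensor_op_adjoint A c w z : hermitian_op dot A ->
  spinor_dot dot (tensor_op A c w) z =
  spinor_dot dot w (tensor_op A (map_mx Num.conj c^T) z).
Proof.
move=> hA; rewrite /spinor_dot /tensor_op /= !mxE.
rewrite !linearDl !linearDr /= !linearZl_LR !linearZr_LR /= !hA !conjCK.
by rewrite addrACA.
Qed.

End TensorOperators.

(** * The Dirac operators: dependence on the base point, and their square *)

Section DiracOperators.
Context {R : realType} {H : completeNormedModType R[i]}.
Local Notation C := R[i].
Local Notation V := (spinor H).
Local Notation point := 'rV[R]_4.
Variable x : 'I_4 -> {linear H -> H}.
Hypothesis bounded_x : forall mu, bounded_op (x mu).
Implicit Types (c : 'I_4 -> 'M[C]_2) (y : point) (w z : V).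

(** The nonzero scalar -2 pi i is left out, which does not change the kernel. The argument [c]
    selects the chirality. *)
Definition reduced_dirac c y w : V := \sum_mu tensor_op (shifted x y mu) (c mu) w.

Lemma bounded_op_blinear (A : {linear H -> H}) : bounded_op A -> blinear A.
Proof.
case=> M hM; split=> [a u v|]; first by rewrite linearP.
exists (complex.Re `|M| + 1) => [|v]; first by rewrite ltr_wpDl // Re_norm_ge0.
(* [M] is any complex number. If the norm of [v] is nonzero, the bound forces [M] to be real and
   nonnegative; otherwise both bounds read 0. *)
have : `|A v| <= `|M| * `|v|.
  rewrite (le_trans (hM v)) //; have := hM v.
  have [->|v0] := eqVneq `|v| 0; first by rewrite !mulr0.
  have v1 : 0 < `|v| by rewrite lt_def v0 normr_ge0.
  move=> h; rewrite ler_wpM2r //; apply: real_ler_norm.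
  have : 0 <= M * `|v| by apply: le_trans h.
  by rewrite pmulr_lge0 // => /ger0_real.
rewrite !rnormE -[`|M|]RRe_real ?normr_real // -rmorphM lecR => /le_trans; apply.
by rewrite ler_wpM2r ?rnorm_ge0 // lerDl.
Qed.

Lemma blinear_shifted y mu : blinear (shifted x y mu).
Proof.
apply: blinear_add; first exact: bounded_op_blinear.
exact/blinear_opp/blinear_scale/blinear_id.
Qed.

(** An operator constant in [y] plus coordinates times constant operators, which is the form covered
    by the smoothness rules. *)
Lemma dirac_affine c y w :
  reduced_dirac c y w = \sum_mu tensor_op (x mu) (c mu) w
    + \sum_mu (y 0 mu)%:C%C *: - tensor_op id (c mu) w.
Proof.
rewrite /reduced_dirac -big_split; apply: eq_bigr => mu _ /=.
rewrite scalerN -tensor_opZl /tensor_op /shifted; congr (_, _) => /=;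
by rewrite !scalerBr opprD addrACA.
Qed.

Lemma Ck_op_dirac (B : set point) k c : open B -> Ck_op B k (reduced_dirac c).
Proof.
move=> oB.
have E y : B y -> (fun w => \sum_mu tensor_op (x mu) (c mu) w
    + \sum_mu (y 0 mu)%:C%C *: - tensor_op id (c mu) w) = reduced_dirac c y.
  by move=> _; apply/funext => w; rewrite dirac_affine.
apply: (Ck_op_eq oB E); apply: (Ck_opD (f := fun _ w => _) ).
  apply: (@Ck_op_sum _ _ _ oB k _ _ (fun mu _ w => tensor_op (x mu) (c mu) w)) => mu.
  exact/Ck_op_cst/blinear_tensor_op/bounded_op_blinear.
apply: (@Ck_op_sum _ _ _ oB k _ _
  (fun mu y w => (y 0 mu)%:C%C *: - tensor_op id (c mu) w)) => mu.
exact/Ck_op_coordinate/blinear_opp/blinear_tensor_op/blinear_id.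
Qed.

Lemma wderiv_sum {T} (w : T -> R) (I : Type) (r : seq I)
    (f : I -> point -> T -> V) A mu y :
  (forall t, 0 <= w t) -> (forall i, wderiv w (f i) mu y (A i)) ->
  wderiv w (fun y t => \sum_(i <- r) f i y t) mu y (fun t => \sum_(i <- r) A i t).
Proof.
move=> w0 fA; elim: r => [|i r IHr].
  rewrite [X in wderiv _ X](_ : _ = fun=> fun=> 0); last first.
    by apply/funext => y'; apply/funext => t; rewrite big_nil.
  rewrite (_ : (fun t => _) = fun=> 0 :> V); last by apply/funext => t; rewrite big_nil.
  exact: wderiv_cst.
rewrite [X in wderiv _ X](_ : _ = fun y t => f i y t + \sum_(j <- r) f j y t); last first.
  by apply/funext => y'; apply/funext => t; rewrite big_cons.
rewrite (_ : (fun t => _) = fun t => A i t + \sum_(j <- r) A j t); last first.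
  by apply/funext => t; rewrite big_cons.
exact: wderivD.
Qed.

(** [Ck_op] hides the derivative behind an existential; the curvature computation needs its
    value. *)
Lemma wderiv_dirac c mu y :
  wderiv (@rnorm R V) (reduced_dirac c) mu y (fun w => - tensor_op id (c mu) w).
Proof.
have -> : (fun w => - tensor_op id (c mu) w) = fun w => 0 +
    \sum_nu ((mu == nu)%:R : R)%:C%C *: - tensor_op id (c nu) w :> V.
  apply/funext => w; rewrite add0r (bigD1 mu) //= eqxx scale1r big1 ?addr0 // => nu.
  by rewrite eq_sym => /negPf ->; rewrite scale0r.
have E : (fun y w => \sum_mu tensor_op (x mu) (c mu) w
    + \sum_mu (y 0 mu)%:C%C *: - tensor_op id (c mu) w) = reduced_dirac c.
  by apply/funext => y'; apply/funext => w; rewrite dirac_affine.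
rewrite -E; apply: wderivD; first by apply: wderiv_cst; exact: rnorm_ge0.
apply: wderiv_sum => [|nu]; first exact: rnorm_ge0.
exact/wderiv_coordinate/blinear_opp/blinear_tensor_op/blinear_id.
Qed.

Lemma commutator_shifted y mu nu v :
  shifted x y mu (shifted x y nu v) - shifted x y nu (shifted x y mu v) =
  commutator (x mu) (x nu) v.
Proof.
have lx i := bounded_op_blinear (bounded_x i).
rewrite /commutator /shifted !(blinearB _ _ (lx _)) !(blinearZ _ _ (lx _)).
rewrite !scalerBr !scalerA.
rewrite [(y 0 nu)%:C%C * _]mulrC !opprB !addrA.
set a := x mu (x nu v); set b := x nu (x mu v).
set p := _ *: x nu v; set q := _ *: x mu v; set r := _ *: v.
by rewrite [LHS](ACl (1*5*2*8*3*6*4*7)) /= !addrK !subrK.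
Qed.

Section DiracSquare.
Variables (cp cm : 'I_4 -> 'M[C]_2).
Hypothesis clifford_cpm : clifford_multiplication cp cm.
Hypothesis comm1 :
  forall v, commutator (x 0) (x 1) v + commutator (x 2) (x 3) v = 0.
Hypothesis comm2 :
  forall v, commutator (x 0) (x 2) v + commutator (x 3) (x 1) v = 0.
Hypothesis comm3 :
  forall v, commutator (x 0) (x 3) v + commutator (x 1) (x 2) v = 0.

Lemma dirac_square y w : reduced_dirac cm y (reduced_dirac cp y w) =
  - tensor_op (fun v => \sum_mu shifted x y mu (shifted x y mu v)) 1%:M w.
Proof.
have [q1 q2 q3] := cmcp_relations clifford_cpm.
pose a v mu nu := shifted x y mu (shifted x y nu v).
(* The contraction lemma takes scalar coefficients, so it is applied to each matrix entry
   separately. *)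
pose q i j mu nu := (cm mu *m cp nu) i j.
have key i j v : \sum_mu \sum_nu q i j mu nu *: a v mu nu =
    (- 1%:M : 'M[C]_2) i j *: \sum_mu a v mu mu.
  apply: contract_asd_commutators; rewrite /q ?q1 ?q2 ?q3 //.
  - by move=> mu; rewrite (cmcp_diag clifford_cpm).
  - by move=> mu nu mn; rewrite (cmcpC clifford_cpm mn) mxE.
  - by rewrite /a !commutator_shifted comm1.
  - by rewrite /a !commutator_shifted comm2.
  - by rewrite /a !commutator_shifted comm3.
rewrite -tensor_opNr.
have -> : reduced_dirac cm y (reduced_dirac cp y w) = \sum_mu \sum_nu
    tensor_op (fun v => a v mu nu) (cm mu *m cp nu) w.
  rewrite /reduced_dirac; apply: eq_bigr => mu _.
  rewrite blinear_sum; last exact/blinear_tensor_op/blinear_shifted.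
  apply: eq_bigr => nu _; rewrite tensor_op_comp //; exact: blinear_shifted.
have pair_sum (f g : 'I_4 -> 'I_4 -> H) : \sum_mu \sum_nu ((f mu nu, g mu nu) : V) =
    (\sum_mu \sum_nu f mu nu, \sum_mu \sum_nu g mu nu).
  rewrite [LHS]surjective_pairing; congr (_, _).
    rewrite (raddf_sum (@fst H H)); apply: eq_bigr => mu _.
    by rewrite (raddf_sum (@fst H H)).
  rewrite (raddf_sum (@snd H H)); apply: eq_bigr => mu _.
  by rewrite (raddf_sum (@snd H H)).
rewrite /tensor_op pair_sum; congr (_, _);
under eq_bigr do rewrite big_split /=; rewrite big_split /=; congr (_ + _); exact: key.
Qed.

End DiracSquare.
End DiracOperators.

(** * Derivatives of sections, as the case of a one-point index type *)

Section VectorCalculus.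
Context {R : realType} {V : normedModType R[i]}.
Local Notation point := 'rV[R]_4.
Local Notation one := (fun _ : unit => 1 : R).
Implicit Types (s : point -> V) (mu : 'I_4) (y : point).

Lemma cvg_wcvg {S} (F : set_system S) {FF : Filter F} (f : S -> V) (l : V) :
  f @ F --> l <-> wcvg one F (fun t _ => f t) (fun=> l).
Proof.
rewrite cvg_rnormP; split=> fl e e0; apply: filterS (fl e e0) => t.
  by move=> h _; rewrite mulr1.
by move=> /(_ tt); rewrite mulr1.
Qed.

Lemma wbounded_one (l : V) : wbounded one (fun=> l).
Proof.
exists (rnorm l + 1); first by rewrite ltr_wpDl ?rnorm_ge0.
by move=> _; rewrite mulr1 lerDl.
Qed.

Definition vderiv s mu y (l : V) := diff_quotient s mu y h @[h --> (0 : R)^'] --> l.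

Lemma vderiv_wderiv s mu y l :
  vderiv s mu y l <-> wderiv one (fun y _ => s y) mu y (fun=> l).
Proof. exact: cvg_wcvg. Qed.

Lemma vderiv_unique s mu y l l' : vderiv s mu y l -> vderiv s mu y l' -> l = l'.
Proof. exact: (@cvg_unique V (@norm_hausdorff _ V)). Qed.

Lemma pderiv_val s mu y l : vderiv s mu y l -> pderiv mu s y = l.
Proof. exact: (@cvg_lim V (@norm_hausdorff _ V)). Qed.

Lemma vderiv_near s s' mu y l :
  (\forall y' \near y, s y' = s' y') -> vderiv s mu y l -> vderiv s' mu y l.
Proof.
move=> E /vderiv_wderiv h; apply/vderiv_wderiv; apply: wderiv_near h.
by apply: filterS E => y' ->.
Qed.

Lemma vderiv_cst (v : V) mu y : vderiv (fun=> v) mu y 0.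
Proof. by apply/vderiv_wderiv; apply: wderiv_cst => _; exact: ler01. Qed.

Lemma vderivB s s' mu y l l' : vderiv s mu y l -> vderiv s' mu y l' ->
  vderiv (fun y => s y - s' y) mu y (l - l').
Proof.
move=> h h'; apply: cvg_trans (cvgB h h'); apply: near_eq_cvg.
apply: nearW => k; rewrite !fctE /diff_quotient -scalerBr; congr (_ *: _).
by rewrite !opprD !addrA [LHS](ACl (1*3*2*4)).
Qed.

(** The product rule for operators with the section regarded as a family of maps from [unit]. *)
Lemma vderiv_app (B : set point) k (f : point -> V -> V) s mu y A l :
  Ck_op B k f -> B y -> blinear A -> wderiv (@rnorm R V) f mu y A ->
  s z @[z --> y] --> s y -> vderiv s mu y l ->
  vderiv (fun y => f y (s y)) mu y (A (s y) + f y l).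
Proof.
move=> fk By lA fA /cvg_wcvg sc /vderiv_wderiv sl; apply/vderiv_wderiv.
apply: (wderiv_comp _ _ lA _ _ sc fA sl) => //; try exact: wbounded_one.
exact: Ck_op_blinear fk By.
Qed.

Lemma cvg_op_app (B : set point) k (f : point -> V -> V) s y :
  Ck_op B k f -> B y -> s z @[z --> y] --> s y ->
  f z (s z) @[z --> y] --> f y (s y).
Proof.
move=> fk By /cvg_wcvg sc; refine ((@cvg_wcvg _ (nbhs y) _ _ _).2 _).
exact: (wcvg_comp (Ck_op_blinear fk By) (Ck_op_continuous fk By)
  (wbounded_one (s y)) sc).
Qed.

Lemma blinear_continuous (A : V -> V) : blinear A -> continuous A.
Proof.
move=> lA v; apply/cvg_rnormP => e e0; have [_ [M M0 hM]] := lA.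
have e1 : 0 < e / M by rewrite divr_gt0.
have : id @ v --> v by [].
move/cvg_rnormP => /(_ _ e1); apply: filterS => u uv.
by rewrite -blinearB // (le_trans (hM _)) // mulrC -ler_pdivlMr.
Qed.

End VectorCalculus.

(** * Uniqueness of orthogonal projections *)

Section OrthogonalProjection.
Context {R : realType} {H : completeNormedModType R[i]}.
Local Notation V := (spinor H).
Variable dot : {dot H for Num.conj}.

Lemma spinor_dotBl (u v w : V) :
  spinor_dot dot (u - v) w = spinor_dot dot u w - spinor_dot dot v w.
Proof. by rewrite /spinor_dot !linearBl opprD addrACA. Qed.

Lemma spinor_dot_eq0 (w : V) : spinor_dot dot w w = 0 -> w = 0.
Proof.
move/eqP; rewrite paddr_eq0 ?dnorm_ge0 // !dnorm_eq0 => /andP[/eqP w1 /eqP w2].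
by case: w w1 w2 => a b /= -> ->.
Qed.

(** The difference of two candidates lies in [E] and is orthogonal to [E], hence to itself. The
    witness [p] guarantees that [xget] returns a candidate. *)
Lemma orthogonal_projection_eq (E : set V) v p : linear_subspace E ->
  is_orthogonal_projection dot E v p -> orthogonal_projection dot E v = p.
Proof.
move=> [_ El] pP; set q := orthogonal_projection _ _ _.
have [Eq qP] : is_orthogonal_projection dot E v q by apply: xgetPex; exists p.
have [Ep pP'] := pP.
have Ed : E (q - p) by have := El (-1) p q Ep Eq; rewrite scaleN1r addrC.
have dE : q - p = (v - p) - (v - q) by rewrite opprB [RHS]addrC subrKA.
apply/eqP; rewrite -subr_eq0; apply/eqP/spinor_dot_eq0.
by rewrite {1}dE spinor_dotBl pP' // qP // subrr.
Qed.

End OrthogonalProjection.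

(** * The kernel bundle: projection, smoothness and curvature *)

Section DiracBundle.
Context {R : realType} {H : completeNormedModType R[i]}.
Local Notation C := R[i].
Local Notation V := (spinor H).
Local Notation point := 'rV[R]_4.
Variables (cp cm : 'I_4 -> 'M[C]_2) (B : set point) (dot : {dot H for Num.conj}).
Variables (x : 'I_4 -> {linear H -> H}) (G : point -> V -> V).
Hypotheses (clifford_cpm : clifford_multiplication cp cm) (B_open : open B)
  (norm_dot : hilbert_norm dot) (bounded_x : forall mu, bounded_op (x mu))
  (hermitian_x : forall mu, hermitian_op dot (x mu)).

Local Notation E := (dirac_kernel x cm).
Local Notation Dp := (reduced_dirac x cp).
Local Notation Dm := (reduced_dirac x cm).
Local Notation T := (tensor_op (H := H) id).

Hypotheses (blinear_G : forall y, B y -> blinear (G y))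
  (DDK : forall y, B y -> cancel (fun w => Dm y (Dp y w)) (G y))
  (GK : forall y, B y -> cancel (G y) (fun w => Dm y (Dp y w)))
  (G_tensor : forall y, B y -> forall c w, G y (T c w) = T c (G y w)).

(** With A = [Dm], whose adjoint A' is - [Dp], and [G] the inverse of [Dm Dp], this is the usual
    projection 1 - A' (A A')^-1 A onto the kernel of A; the two signs cancel. *)
Definition kernel_projection y (w : V) : V := w - Dp y (G y (Dm y w)).
Local Notation P := kernel_projection.

Lemma dirac_kernelP y w : E y w <-> Dm y w = 0.
Proof.
rewrite /dirac_kernel /dirac_op /=; split => [/eqP|]; last first.
  by rewrite /reduced_dirac => ->; rewrite scaler0.
rewrite scaler_eq0 oppr_eq0 !mulf_eq0 pnatr_eq0 /= => /orP[|/eqP //].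
rewrite -[0]/((0 : R)%:C%C) !eq_complex /= !eqxx !andbT oner_eq0 andbF orbF.
by rewrite gt_eqF // pi_gt0.
Qed.

Lemma blinear_dirac c y : blinear (reduced_dirac x c y).
Proof. by have := Ck_op_blinear (Ck_op_dirac bounded_x 0 c openT) (I : setT y). Qed.

(** Each x_mu - y_mu is Hermitian because y_mu is real; the sign is that of [cm mu] as minus the
    adjoint of [cp mu]. *)
Lemma dirac_adjoint y w z :
  spinor_dot dot (Dp y w) z = - spinor_dot dot w (Dm y z).
Proof.
have [cmE _ _ _ _] := clifford_cpm.
have sumE (u : V) : spinor_dot dot (Dp y w) u =
    \sum_mu spinor_dot dot (tensor_op (shifted x y mu) (cp mu) w) u.
  rewrite /reduced_dirac; elim/big_rec2: _ => [|mu a b _ <-].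
    by rewrite /spinor_dot !linear0l addr0.
  by rewrite /spinor_dot !linearDl /= addrACA.
have sumE' : spinor_dot dot w (Dm y z) =
    \sum_mu spinor_dot dot w (tensor_op (shifted x y mu) (cm mu) z).
  rewrite /reduced_dirac; elim/big_rec2: _ => [|mu a b _ <-].
    by rewrite /spinor_dot !linear0r addr0.
  by rewrite /spinor_dot !linearDr /= addrACA.
rewrite sumE sumE' -sumrN; apply: eq_bigr => mu _.
rewrite tensor_op_adjoint; last first.
  move=> u v; rewrite /shifted linearBl linearBr /= linearZl_LR linearZr_LR /=.
  by rewrite hermitian_x conj_Creal //; apply/complex_realP; exists (y 0 mu).
rewrite cmE tensor_opNr /spinor_dot /= !linearNr /= opprD !opprK.
by [].
Qed.

Section AtPoint.
Variable y : point.
Hypothesis By : B y.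

Lemma blinear_kernel_projection : blinear (P y).
Proof.
apply: blinear_add (@blinear_id R V) _; apply: blinear_opp.
apply: blinear_comp; first exact: blinear_dirac.
by apply: blinear_comp; [exact: blinear_G|exact: blinear_dirac].
Qed.

Lemma dirac_kernel_projection w : Dm y (P y w) = 0.
Proof. by rewrite /P (blinearB _ _ (blinear_dirac cm y)) GK // subrr. Qed.

Lemma kernel_projection_dirac w : P y (Dp y w) = 0.
Proof. by rewrite /P (DDK By) subrr. Qed.

Lemma linear_subspace_dirac_kernel : linear_subspace (E y).
Proof.
split; first exact/dirac_kernelP/blinear0/blinear_dirac.
move=> a v w /dirac_kernelP v0 /dirac_kernelP w0; apply/dirac_kernelP.
by rewrite (blinear_dirac cm y).1 v0 w0 scaler0 addr0.
Qed.

Lemma closed_dirac_kernel : closed (E y).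
Proof.
rewrite (_ : E y = Dm y @^-1` [set 0]); last first.
  by apply/seteqP; split => w /dirac_kernelP.
apply: preimage_closed; last first.
  exact/accessible_closed_set1/hausdorff_accessible/norm_hausdorff.
by move=> w _; apply: blinear_continuous; exact: blinear_dirac.
Qed.

(** [w - P y w] lies in the range of [Dp y], which [dirac_adjoint] makes orthogonal to the kernel of
    [Dm y]. *)
Lemma kernel_projection_orthogonal w : is_orthogonal_projection dot (E y) w (P y w).
Proof.
split; first exact/dirac_kernelP/dirac_kernel_projection.
move=> z /dirac_kernelP z0; rewrite /P subKr dirac_adjoint z0.
by rewrite /spinor_dot !linear0r addr0 oppr0.
Qed.

Lemma orthogonal_projection_kernel w : orthogonal_projection dot (E y) w = P y w.
Proof.
apply: orthogonal_projection_eq; first exact: linear_subspace_dirac_kernel.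
exact: kernel_projection_orthogonal.
Qed.

End AtPoint.

Lemma Ck_op_G k : Ck_op B k G.
Proof.
apply: (Ck_op_inverse B_open blinear_G DDK GK).
by apply: Ck_op_comp => //; exact: Ck_op_dirac.
Qed.

Lemma dirac_kernel_bundle : nonsingular_hermitian_bundle dot B E.
Proof.
split=> [y By|k].
  split; [exact: linear_subspace_dirac_kernel|exact: closed_dirac_kernel|].
  move=> v; rewrite orthogonal_projection_kernel //.
  exact: kernel_projection_orthogonal.
apply: Ck_op_Ck.
have PE y : B y -> (fun w => w + - Dp y (G y (Dm y w))) = orthogonal_projection dot (E y).
  by move=> By; apply/funext => w; rewrite orthogonal_projection_kernel.
apply: (Ck_op_eq B_open PE).
apply: (Ck_opD (Ck_op_cst _ _ (@blinear_id R V))).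
apply: (Ck_op_comp (Ck_op_cst _ _ (blinear_opp (@blinear_id R V)))).
apply: Ck_op_comp; first exact: Ck_op_dirac.
apply: Ck_op_comp; first exact: Ck_op_G.
exact: Ck_op_dirac.
Qed.

Section Curvature.
Variable s : point -> V.
Hypothesis s_section : smooth_section B E s.

(** Smoothness provides derivatives for each order separately. Unfolding order 2 once makes the
    second derivatives belong to the chosen first ones; choice turns them into families over the
    indices. *)
Lemma smooth_section_derivatives : exists g : 'I_4 -> point -> V,
  exists g2 : 'I_4 -> 'I_4 -> point -> V,
  [/\ forall y, B y -> s z @[z --> y] --> s y,
      forall mu y, B y -> vderiv s mu y (g mu y),
      forall mu y, B y -> g mu z @[z --> y] --> g mu y,
      forall mu nu y, B y -> vderiv (g mu) nu y (g2 mu nu y) &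
      forall mu nu y, B y -> g2 mu nu z @[z --> y] --> g2 mu nu y].
Proof.
have [/(_ 2%N) [sc sd] _] := s_section.
have /choice[g gP] : forall mu, exists g : point -> V,
    (forall y, B y -> vderiv s mu y (g y)) /\ Ck (@vec_cvg R V) B 1 g.
  by move=> mu; have [g dg g1] := sd mu; exists g.
have /choice[g2 g2P] : forall mn : 'I_4 * 'I_4, exists h : point -> V,
    (forall y, B y -> vderiv (g mn.1) mn.2 y (h y)) /\ Ck (@vec_cvg R V) B 0 h.
  by move=> [mu nu]; have [_ [_ /(_ nu)[h dh h0]]] := gP mu; exists h.
exists g, (fun mu nu => g2 (mu, nu)); split=> //.
- by move=> mu; exact: (gP mu).1.
- by move=> mu; exact: (gP mu).2.1.
- by move=> mu nu; exact: (g2P (mu, nu)).1.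
- by move=> mu nu; exact: (g2P (mu, nu)).2.1.
Qed.

Variables (g : 'I_4 -> point -> V) (g2 : 'I_4 -> 'I_4 -> point -> V).
Hypotheses (s_cont : forall y, B y -> s z @[z --> y] --> s y)
  (s_deriv : forall mu y, B y -> vderiv s mu y (g mu y))
  (g_cont : forall mu y, B y -> g mu z @[z --> y] --> g mu y)
  (g_deriv : forall mu nu y, B y -> vderiv (g mu) nu y (g2 mu nu y))
  (g2_cont : forall mu nu y, B y -> g2 mu nu z @[z --> y] --> g2 mu nu y).

Lemma near_B y : B y -> \forall z \near y, B z.
Proof. by move=> By; apply: open_nbhs_nbhs. Qed.

Lemma vderiv_dirac c (t : point -> V) mu y l : B y ->
  t z @[z --> y] --> t y -> vderiv t mu y l ->
  vderiv (fun y => reduced_dirac x c y (t y)) mu y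
    (- T (c mu) (t y) + reduced_dirac x c y l).
Proof.
move=> By tc tl; apply: (vderiv_app (Ck_op_dirac bounded_x 0 c B_open) By _
  (wderiv_dirac _ _ _ _) tc tl).
exact/blinear_opp/blinear_tensor_op/blinear_id.
Qed.

Lemma dirac_deriv_section nu y : B y -> Dm y (g nu y) = T (cm nu) (s y).
Proof.
move=> By; have d := @vderiv_dirac cm s nu y _ By (s_cont By) (@s_deriv nu _ By).
have d0 : vderiv (fun y => Dm y (s y)) nu y 0.
  apply: vderiv_near (vderiv_cst 0 nu y); apply: filterS (near_B By) => z Bz.
  by rewrite (dirac_kernelP _ _).1 //; exact: s_section.2.
have := vderiv_unique d d0; rewrite addrC => /eqP.
by rewrite subr_eq0 => /eqP.
Qed.

Lemma subbundle_connection_section nu y : B y ->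
  subbundle_connection dot E nu s y = P y (g nu y).
Proof.
move=> By; rewrite /subbundle_connection orthogonal_projection_kernel //.
by rewrite (pderiv_val (@s_deriv nu _ By)).
Qed.

(* P annihilates the image of Dp, so the derivatives of the other factors of
   Dp (G (Dm (g nu))) do not contribute. *)
Lemma second_connection mu nu y : B y ->
  subbundle_connection dot E mu (subbundle_connection dot E nu s) y =
  P y (g2 nu mu y) + P y (T (cp mu *m cm nu) (G y (s y))).
Proof.
move=> By; have lP := blinear_kernel_projection By.
pose u z := G z (Dm z (g nu z)).
have uE : u y = T (cm nu) (G y (s y)).
  by rewrite /u dirac_deriv_section // G_tensor.
have cDg := @cvg_op_app _ _ B 0%N Dm (g nu) y (Ck_op_dirac bounded_x 0 cm B_open) By
  (@g_cont nu _ By).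
have cu := @cvg_op_app _ _ B 0%N G (fun z => Dm z (g nu z)) y (Ck_op_G 0) By cDg.
have [u' du] : exists u', vderiv u mu y u'.
  have [G' dG G'0] := (Ck_op_G 1).2 mu.
  have dDg := @vderiv_dirac cm (g nu) mu y _ By (@g_cont nu _ By) (@g_deriv nu mu _ By).
  pose proof (@vderiv_app _ _ B 0%N G (fun z => Dm z (g nu z)) mu y _ _
    (Ck_op_G 0) By (G'0.1 _ By).1 (dG _ By) cDg dDg) as du.
  exact: (ex_intro _ _ du).
have d := vderivB (@g_deriv nu mu _ By) (@vderiv_dirac cp u mu y _ By cu du).
(* The formula for the connection holds on [B], which is open, so it may be differentiated at
   [y]. *)
have {}d : vderiv (subbundle_connection dot E nu s) mu y
    (g2 nu mu y - (- T (cp mu) (u y) + Dp y u')).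
  apply: vderiv_near d; apply: filterS (near_B By) => z Bz.
  by rewrite subbundle_connection_section.
rewrite {1}/subbundle_connection orthogonal_projection_kernel // (pderiv_val d).
rewrite (blinearB _ _ lP) (blinearD _ _ lP) (blinearN _ lP) kernel_projection_dirac //.
by rewrite addr0 opprK uE tensor_op_comp //; exact: blinear_id.
Qed.

Lemma curvature_section mu nu y : B y -> curvature dot E mu nu s y =
  P y (T (cp mu *m cm nu - cp nu *m cm mu) (G y (s y))).
Proof.
move=> By; rewrite /curvature !second_connection //.
(* [g2 nu mu] differentiates along [nu] and then along [mu]; equality of the two orders removes the
   second derivatives from the curvature. *)
have -> : g2 nu mu y = g2 mu nu y.
  exact: (clairaut_spinor norm_dot B_open By (@s_deriv nu) (@s_deriv mu) (@g_deriv nu mu)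
    (@g_deriv mu nu) (@g2_cont nu mu _ By) (@g2_cont mu nu _ By)).
rewrite opprD addrACA subrr add0r -(blinearB _ _ (blinear_kernel_projection By)).
by rewrite tensor_opDr tensor_opNr.
Qed.

Lemma curvature_section_asd y : B y ->
  anti_self_dual (fun mu nu => curvature dot E mu nu s y).
Proof.
move=> By; have [r1 r2 r3] := cpcm_relations clifford_cpm.
have lP := blinear_kernel_projection By.
(* [P y (T c w)] is additive in the matrix [c], so the relations between Clifford matrices pass to
   the curvature. *)
have P0 c c' w : c + c' = 0 -> P y (T c w) + P y (T c' w) = 0.
  move=> cc; rewrite -(blinearD _ _ lP) -tensor_opDr cc -(scale0r (0 : 'M[C]_2)).
  by rewrite tensor_opZr scale0r (blinear0 lP).
have cE mu nu := @curvature_section mu nu y By.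
apply: two_form_asd => [mu nu|||]; last 3 first.
- by rewrite !cE; exact: P0 r1.
- by rewrite !cE; exact: P0 r2.
- by rewrite !cE; exact: P0 r3.
by rewrite /curvature opprB.
Qed.

End Curvature.

Lemma dirac_kernel_asd : subbundle_connection_ASD dot B E.
Proof.
move=> s sP y By; have [g [g2 [h1 h2 h3 h4 h5]]] := smooth_section_derivatives sP.
exact: (curvature_section_asd sP h1 h2 h3 h4 h5 By).
Qed.

End DiracBundle.

(** * The inverse of [Dm Dp] from the inverse Laplacian, and the conclusion *)

Theorem proposition3p1 (R : realType)
    (cp cm : 'I_4 -> 'M[R[i]]_2)
    (clifford_cpm : clifford_multiplication cp cm)
    (B : set 'rV[R]_4) (domain_B : domain B) (bounded_B : bounded_set B)
    (H : completeNormedModType R[i]) (dot : {dot H for Num.conj})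
    (norm_dot : hilbert_norm dot)
    (x : 'I_4 -> {linear H -> H})
    (bounded_x : forall mu, bounded_op (x mu))
    (hermitian_x : forall mu, hermitian_op dot (x mu))
    (comm1 : forall v, commutator (x 0) (x 1) v + commutator (x 2) (x 3) v = 0)
    (comm2 : forall v, commutator (x 0) (x 2) v + commutator (x 3) (x 1) v = 0)
    (comm3 : forall v, commutator (x 0) (x 3) v + commutator (x 1) (x 2) v = 0)
    (invertible_laplacian : forall y, B y -> invertible_op (laplacian x y)) :
  nonsingular_hermitian_bundle dot B (dirac_kernel x cm) /\
  subbundle_connection_ASD dot B (dirac_kernel x cm).
Proof.
have [B_open _ _] := domain_B.
pose L y (v : H) := \sum_mu shifted x y mu (shifted x y mu v).
(* The Laplacian is [k] times [L y]; if [K0] inverts it, then [k] times [K0] inverts [L y]. *)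
pose k : R[i] := (4 * pi ^+ 2)%:C%C.
have [K KP] : exists K : 'rV[R]_4 -> H -> H, forall y, B y ->
    [/\ blinear (K y), cancel (L y) (K y) & cancel (K y) (L y)].
  have /choice[K KP] : forall y, exists K : H -> H, B y ->
      [/\ blinear K, cancel (L y) K & cancel K (L y)].
    (* Outside [B] the value is arbitrary, and [id] is taken. *)
    move=> y; have [By|nBy] := pselect (B y); last by exists id.
    have [K0 bK [LK KL]] := invertible_laplacian y By.
    have lK0 := bounded_op_blinear bK; have lK := blinear_scale k lK0.
    exists (fun v => k *: K0 v) => _; split => // v.
      by rewrite -(blinearZ _ _ lK0); exact: LK.
    have k0 : k != 0.
      rewrite /k -(rmorph0 (real_complex R)) (inj_eq (@complexI R)) gt_eqF //.
      by rewrite mulr_gt0 // exprn_gt0 // pi_gt0.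
    by apply: (scalerI k0); rewrite -[RHS]KL (blinearZ _ _ lK0).
  by exists K.
(* The sign matches that of the Dirac square. The identity matrix in the second factor makes [G y]
   commute with every Clifford matrix. *)
pose G y : spinor H -> spinor H := fun w => - tensor_op (K y) 1%:M w.
have lG y : B y -> blinear (G y).
  by move=> /KP[lK _ _]; exact/blinear_opp/blinear_tensor_op.
have DD y w : reduced_dirac x cm y (reduced_dirac x cp y w) = - tensor_op (L y) 1%:M w.
  exact: (dirac_square bounded_x clifford_cpm comm1 comm2 comm3).
have lL y : blinear (L y).
  apply: blinear_big_sum => mu.
  exact: blinear_comp (blinear_shifted bounded_x y mu) (blinear_shifted bounded_x y mu).
have tensorN A c w : blinear A -> tensor_op A c (- w) = - tensor_op A c w.
  by move=> lA; rewrite (blinearN _ (blinear_tensor_op c lA)).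
have DDK y : B y -> cancel (fun w => reduced_dirac x cm y (reduced_dirac x cp y w)) (G y).
  move=> By w; have [lK LK KL] := KP y By.
  rewrite /G DD tensorN // opprK tensor_op_comp // mulmx1.
  by rewrite (tensor_op_eq _ _ LK) tensor_op_id.
have GK y : B y -> cancel (G y) (fun w => reduced_dirac x cm y (reduced_dirac x cp y w)).
  move=> By w; have [lK LK KL] := KP y By.
  rewrite /G DD tensorN // opprK tensor_op_comp // mulmx1.
  by rewrite (tensor_op_eq _ _ KL) tensor_op_id.
have GT y : B y -> forall c w, G y (tensor_op id c w) = tensor_op id c (G y w).
  move=> By c w; have [lK _ _] := KP y By; have lid := @blinear_id R H.
  by rewrite /G tensorN // !tensor_op_comp // mul1mx mulmx1.
split.
  exact: (dirac_kernel_bundle clifford_cpm B_open bounded_x hermitian_x lG DDK GK).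
exact: (dirac_kernel_asd clifford_cpm B_open norm_dot bounded_x hermitian_x lG DDK
  GK GT).
Qed.
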